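(* Let $\alpha<0$, let $\mathcal{A}\neq0$ be a real antisymmetric $n\times n$ matrix, let $\mathbf{C}:\mathbb{R}\to\mathbb{R}^n$ be a rotating-dilating soliton with parameters $(\alpha,\mathcal{A})$, let $\omega(\mathbf{X})$ be the $\omega$-limit set of the corresponding orbit $\mathbf{X}$, and assume $V_+=\lim_{s\to\infty}V(\mathbf{C}(s),\mathbf{C}_s(s))=0$. If $\omega(\mathbf{X})$ is not contained in $\overline{N(\mathcal{A})}\times\mathbb{S}^{n-1}$, then $(\mathbf{C}(s),\mathbf{C}_s(s))\in\mathcal{R}_-(K)$ for some large enough $K$ and all large enough $s$. In this case the soliton $\mathbf{C}$ is asymptotic to a logarithmic spiral: there is a constant vector $\Gamma\neq0$ with \[ \mathbf{C}=e^{-\sigma(\alpha+\mathcal{A})}\Gamma+\mathcal{O}(e^{\alpha\sigma})\qquad(\sigma\to\infty),\qquad \sigma=\int\frac{ds}{\|(\alpha+\mathcal{A})\mathbf{C}(s)\|}. \] In particular $\omega(\mathbf{X})$ is disjoint from $N(\mathcal{A})$, i.e. it contains no point $(\mathbf{P},\mathbf{T})$ with $\mathcal{A}\mathbf{P}=0$.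
   Context: For a nonzero vector $\mathbf{u}$, $\mathfrak{p}_{\mathbf{u}}(\mathbf{w})=\mathbf{w}-\frac{\langle\mathbf{w},\mathbf{u}\rangle}{\|\mathbf{u}\|^2}\mathbf{u}$. A rotating-dilating soliton with parameters $(\alpha,\mathcal{A})$ is an arc length parametrized curve $\mathbf{C}:\mathbb{R}\to\mathbb{R}^n$ with $\mathbf{C}_{ss}=\mathfrak{p}_{\mathbf{C}_s}[(\alpha+\mathcal{A})\mathbf{C}]$ ($\alpha$ stands for $\alpha$ times the identity); $\mathbf{T}=\mathbf{C}_s$. Its corresponding orbit is $\mathbf{X}=(\mathbf{P},\mathbf{T})\in\mathbb{B}^n\times\mathbb{S}^{n-1}$ with $\mathbf{P}=\mathbf{C}/\sqrt{1+\|\mathbf{C}\|^2}$ ($\mathbb{B}^n$ the closed unit ball), and $\omega(\mathbf{X})=\bigcap_{s>0}\overline{\{\mathbf{X}(s'):s'\geq s\}}$. $\overline{N(\mathcal{A})}=\{\mathbf{P}\in\mathbb{B}^n:\mathcal{A}\mathbf{P}=0\}$ is the closure in $\mathbb{B}^n$ of the image of the null space $N(\mathcal{A})$ under $\mathbf{C}\mapsto\mathbf{P}$. The function $V(\mathbf{C},\mathbf{T})=e^{\frac{\alpha}{2}\|\mathbf{C}\|^2}\langle\mathbf{T},\mathcal{A}\mathbf{C}\rangle$ is bounded and nondecreasing along solitons, so $V_+$ exists. With $\mathbf{a}=(\alpha+\mathcal{A})\mathbf{C}$, $\hat{\mathbf{a}}=\mathbf{a}/\|\mathbf{a}\|$,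 $\mu=\langle\hat{\mathbf{a}},\mathbf{T}\rangle$, $\nu=\|\mathbf{a}\|^4(1-\mu^2)$, one sets $\mathcal{R}_-(K)=\{(\mathbf{C},\mathbf{T}):\|\mathbf{a}\|\geq K,\ \nu\leq K,\ \mu<0\}$. *)

(* Defs.v *)
From HB Require Import structures.
From mathcomp Require Import all_boot all_order all_algebra.
From mathcomp Require Import all_classical all_reals all_analysis.

Set Implicit Arguments.
Unset Strict Implicit.
Unset Printing Implicit Defensive.

Import Order.TTheory GRing.Theory Num.Theory.
Import numFieldNormedType.Exports.

Local Open Scope classical_set_scope.
Local Open Scope ring_scope.

(* The library norm `|u| on column vectors is the sup norm; it gives the usual
   topology of R^n, but <., .> and || . || below are the Euclidean ones. *)
Definition dotv (R : realType) (n : nat) (u v : 'cV[R]_n) : R :=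
  \sum_(i < n) u i 0 * v i 0.

Definition enorm (R : realType) (n : nat) (u : 'cV[R]_n) : R :=
  Num.sqrt (dotv u u).

Definition expmx (R : realType) (n : nat) (M : 'M[R]_n) : 'M[R]_n :=
  limn (series (fun k : nat => k`!%:R^-1 *: M ^+ k)).

Definition orthproj (R : realType) (n : nat) (u w : 'cV[R]_n) : 'cV[R]_n :=
  w - (dotv w u / enorm u ^+ 2) *: u.

Definition avec (R : realType) (n : nat) (alpha : R) (A : 'M[R]_n)
    (C : 'cV[R]_n) : 'cV[R]_n :=
  (alpha%:M + A) *m C.

Definition soliton (R : realType) (n : nat) (alpha : R) (A : 'M[R]_n)
    (C : R -> 'cV[R]_n) : Prop :=
  forall s : R,
    [/\ derivable C s 1,
        enorm (derive1 C s) = 1,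
        derivable (derive1 C) s 1 &
        derive1 (derive1 C) s = orthproj (derive1 C s) (avec alpha A (C s))].

Definition orbit_pt (R : realType) (n : nat) (C : R -> 'cV[R]_n) (s : R) :
    'cV[R]_n * 'cV[R]_n :=
  ((Num.sqrt (1 + enorm (C s) ^+ 2))^-1 *: C s, derive1 C s).

(* The closure is taken in R^n x R^n, in which B^n x S^(n-1) is closed. *)
Definition omega_limit (R : realType) (n : nat)
    (X : R -> 'cV[R]_n * 'cV[R]_n) : set ('cV[R]_n * 'cV[R]_n) :=
  \bigcap_(s in [set s : R | 0 < s]) closure (X @` [set s' : R | s <= s']).

Definition unit_sphere (R : realType) (n : nat) : set 'cV[R]_n :=
  [set T | enorm T = 1].

(* The closure of the null space of A in the closed unit ball B^n. *)
Definition null_closure (R : realType) (n : nat) (A : 'M[R]_n) :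
    set 'cV[R]_n :=
  [set P | enorm P <= 1 /\ A *m P = 0].

Definition Vfun (R : realType) (n : nat) (alpha : R) (A : 'M[R]_n)
    (C T : 'cV[R]_n) : R :=
  expR (alpha / 2 * enorm C ^+ 2) * dotv T (A *m C).

(* With 0^-1 = 0, mu = 0 where (alpha + A) C = 0; such points are therefore
   excluded from Rminus by mu < 0. *)
Definition mu (R : realType) (n : nat) (alpha : R) (A : 'M[R]_n)
    (C T : 'cV[R]_n) : R :=
  dotv ((enorm (avec alpha A C))^-1 *: avec alpha A C) T.

Definition nu (R : realType) (n : nat) (alpha : R) (A : 'M[R]_n)
    (C T : 'cV[R]_n) : R :=
  enorm (avec alpha A C) ^+ 4 * (1 - mu alpha A C T ^+ 2).

Definition Rminus (R : realType) (n : nat) (alpha : R) (A : 'M[R]_n) (K : R) :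
    set ('cV[R]_n * 'cV[R]_n) :=
  [set x | [/\ K <= enorm (avec alpha A x.1),
               nu alpha A x.1 x.2 <= K &
               mu alpha A x.1 x.2 < 0]].

(* sigma = int ds / ||(alpha + A) C(s)||: an antiderivative, determined up to
   an additive constant, on a half-line on which (alpha + A) C(s) <> 0. *)
Definition log_parameter (R : realType) (n : nat) (alpha : R) (A : 'M[R]_n)
    (C : R -> 'cV[R]_n) (sigma : R -> R) : Prop :=
  \forall s \near +oo_R,
    avec alpha A (C s) != 0 /\
    is_derive s 1 sigma (enorm (avec alpha A (C s)))^-1.

(* Main.v *)
Require Import Defs.
From HB Require Import structures.
From mathcomp Require Import all_boot all_order all_algebra.
From mathcomp Require Import all_classical all_reals all_analysis.
From mathcomp Require Import ring lra.

Set Implicit Arguments.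
Unset Strict Implicit.
Unset Printing Implicit Defensive.

Import Order.TTheory GRing.Theory Num.Theory.
Import numFieldNormedType.Exports.

Local Open Scope classical_set_scope.
Local Open Scope ring_scope.

(** The curve satisfies T' = b, where a = (alpha + A) C, m = <a, T> and
    b = a - m T is the normal component of a, of squared length k = |a|^2 - m^2.
    With r = |C|^2 and w = |A C|^2, everything follows from a closed system of
    differential equations and Cauchy-Schwarz inequalities for a few such scalar
    functions of arc length ([scalar_soliton]); in particular m' = alpha + k
    and k' = 2 <A T, b> - 2 m k.

    V is nondecreasing and tends to 0, so <T, A C> <= 0 along the whole curve
    ([dotTAC_le0]).  When m >= 0 this forces k >= w ([sqcurv_ge_sqAC]): T cannot
    be close to a, for then <T, A C> would be positive.  A limit point outside
    the null space of A gives arc lengths with w >= c (1 + r) infinitely often;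
    there r is unbounded, as otherwise V would increase by a fixed amount
    infinitely often ([radius_unbounded]).

    The core is [curvature_bound]: if w >= c r and r is large at s, then m < 0
    and k r <= K at s.  On the unit interval after s, whose length is enormous
    compared with the time scale 1 / |C| of the system, the function
    k exp(L m / |C(s)|) grows at an exponential rate of order |C(s)|: where
    m < 0 because the normal component is repelled from 0, where m >= 0 because
    k >= w makes m itself increase.  As it is at most of order r, it must have
    been at most of order 1 / r at s.

    When m < 0 and k r <= K, the curve moves almost along - a, so r increases,
    and (w - L) / r is nondecreasing for a suitable constant L.  A continuous
    induction then shows that w >= c r, m < 0 and k r <= K persist for all
    later arc lengths ([persistence]).  This yields the region R_-(K) and,
    w / r being bounded below, the absence of limit points in the null space.

    Finally |T + a / |a| |^2 <= 2 k / |a|^2.  In terms of the parameter sigma,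
    exp(2 alpha sigma) r has an integrable logarithmic derivative, so it stays
    between two positive constants ([scaled_bounds]), and hence sigma tends to
    infinity.  The curve Y = exp(sigma (alpha + A)) C has speed
    O(exp(2 alpha sigma)) with respect to sigma, so it converges to some Gamma
    with |Y - Gamma| = O(exp(2 alpha sigma)) ([unwound_speed], [curve_limit]).
    As exp(t (alpha + A)) multiplies lengths by exp(alpha t) ([dotv_Phi]), this
    is the asserted estimate, and Gamma is not 0 because |Y| is bounded below. *)

(** * Euclidean vectors *)

Section Euclid.
Context {R : realType} {n : nat}.
Implicit Types (u v w : 'cV[R]_n) (M : 'M[R]_n).

Lemma dotvC u v : dotv u v = dotv v u.
Proof. by apply: eq_bigr => i _; rewrite mulrC. Qed.

Lemma dotvDl u v w : dotv (u + v) w = dotv u w + dotv v w.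
Proof.
by rewrite /dotv -big_split; apply: eq_bigr => i _; rewrite mxE mulrDl.
Qed.

Lemma dotvZl a u w : dotv (a *: u) w = a * dotv u w.
Proof.
by rewrite /dotv mulr_sumr; apply: eq_bigr => i _; rewrite mxE mulrA.
Qed.

Lemma dotvNl u w : dotv (- u) w = - dotv u w.
Proof. by rewrite -scaleN1r dotvZl mulN1r. Qed.

Lemma dotvBl u v w : dotv (u - v) w = dotv u w - dotv v w.
Proof. by rewrite dotvDl dotvNl. Qed.

Lemma dotvDr u v w : dotv w (u + v) = dotv w u + dotv w v.
Proof. by rewrite !(dotvC w) dotvDl. Qed.

Lemma dotvZr a u w : dotv w (a *: u) = a * dotv w u.
Proof. by rewrite !(dotvC w) dotvZl. Qed.

Lemma dotvBr u v w : dotv w (u - v) = dotv w u - dotv w v.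
Proof. by rewrite !(dotvC w) dotvBl. Qed.

Lemma dotv_ge0 u : 0 <= dotv u u.
Proof. by apply: sumr_ge0 => i _; rewrite -expr2 sqr_ge0. Qed.

Lemma dotv0l u : dotv 0 u = 0.
Proof. by rewrite -(scale0r 0) dotvZl mul0r. Qed.

Lemma dotv_eq0 u : (dotv u u == 0) = (u == 0).
Proof.
apply/eqP/eqP => [|->]; last by rewrite dotv0l.
move/psumr_eq0P => h; apply/colP => i; rewrite mxE; apply/eqP.
by rewrite -sqrf_eq0 expr2 h // => j _; rewrite -expr2 sqr_ge0.
Qed.

Lemma dotv_CS u v : dotv u v ^+ 2 <= dotv u u * dotv v v.
Proof.
have [v0|vn0] := eqVneq (dotv v v) 0.
  by move/eqP: v0; rewrite dotv_eq0 => /eqP ->; rewrite dotvC !dotv0l mulr0 expr0n.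
have vgt0 : 0 < dotv v v by rewrite lt_def vn0 dotv_ge0.
rewrite -subr_ge0 -(pmulr_rge0 _ vgt0).
have := dotv_ge0 (dotv v v *: u - dotv u v *: v).
rewrite dotvBl !dotvBr !dotvZl !dotvZr (dotvC v u).
by congr (_ <= _); ring.
Qed.

Lemma dotv_mulmx M u v : dotv (M *m u) v = dotv u (M^T *m v).
Proof.
rewrite /dotv; under eq_bigr do rewrite mxE mulr_suml.
rewrite exchange_big; apply: eq_bigr => j _; rewrite mxE mulr_sumr.
by apply: eq_bigr => i _; rewrite mxE mulrCA mulrA.
Qed.

Lemma enorm_sqr u : enorm u ^+ 2 = dotv u u.
Proof. by rewrite sqr_sqrtr // dotv_ge0. Qed.

Lemma enorm_ge0 u : 0 <= enorm u.
Proof. exact: sqrtr_ge0. Qed.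

Lemma coord_le_dotv u i : u i 0 ^+ 2 <= dotv u u.
Proof.
rewrite /dotv (bigD1 i) //= -expr2 lerDl.
by apply: sumr_ge0 => j _; rewrite -expr2 sqr_ge0.
Qed.

(** The squared operator norm of a matrix is finite. *)
Lemma mulmx_bound M : exists2 N : R, 0 < N &
  forall u, dotv (M *m u) (M *m u) <= N * dotv u u.
Proof.
exists (1 + \sum_(i < n) dotv (row i M)^T (row i M)^T).
  by rewrite ltr_pwDl // sumr_ge0 // => i _; exact: dotv_ge0.
move=> u; rewrite mulrDl mul1r ler_wpDl ?dotv_ge0 //.
rewrite mulr_suml; apply: ler_sum => i _.
suff -> : (M *m u) i 0 = dotv (row i M)^T u by rewrite -expr2 dotv_CS.
by rewrite mxE; apply: eq_bigr => j _; rewrite !mxE.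
Qed.

Lemma dotv_anti M u : M^T = - M -> dotv u (M *m u) = 0.
Proof.
move=> Ma; have := dotv_mulmx M u u; rewrite Ma mulNmx (dotvC u (- _)) dotvNl.
by rewrite (dotvC u) => h; lra.
Qed.

End Euclid.

(** * One-variable calculus *)

Section Calculus.
Context {R : realType}.
Implicit Types (f g : R -> R) (s t : R).

Lemma is_deriveM_fun f g s df dg : is_derive s 1 f df -> is_derive s 1 g dg ->
  is_derive s 1 (fun t => f t * g t) (df * g s + f s * dg).
Proof.
move=> hf hg; apply: is_derive_eq (is_deriveM hf hg) _.
by rewrite addrC mulrC.
Qed.

Lemma is_deriveD_fun f g s df dg : is_derive s 1 f df -> is_derive s 1 g dg ->
  is_derive s 1 (fun t => f t + g t) (df + dg).
Proof. exact: is_deriveD. Qed.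

Lemma is_deriveB_fun f g s df dg : is_derive s 1 f df -> is_derive s 1 g dg ->
  is_derive s 1 (fun t => f t - g t) (df - dg).
Proof. exact: is_deriveB. Qed.

Lemma is_derive_cst_fun (c : R) s : is_derive s 1 (fun=> c : R) (0 : R).
Proof. exact: is_derive_cst. Qed.

Lemma is_deriveZ_fun f s df (c : R) : is_derive s 1 f df ->
  is_derive s 1 (fun t => c * f t) (c * df).
Proof. exact: is_deriveZ. Qed.

Lemma is_derive_expR_fun f s df : is_derive s 1 f df ->
  is_derive s 1 (fun t => expR (f t)) (df * expR (f s)).
Proof.
by move=> hf; have := is_derive1_comp (is_derive_expR (f s)) hf; rewrite mulrC.
Qed.

Lemma is_deriveV_fun f s df : f s != 0 -> is_derive s 1 f df ->
  is_derive s 1 (fun t => (f t)^-1) (- df / f s ^+ 2).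
Proof.
move=> f0 hf; apply: is_derive_eq (is_deriveV f0 hf) _.
by rewrite /GRing.scale /= !mulNr mulrC.
Qed.

Lemma is_derive_continuous f s df : is_derive s 1 f df -> {for s, continuous f}.
Proof. by move=> [df1 _]; exact/differentiable_continuous/derivable1_diffP. Qed.

Lemma derive_ge0_le f f' a b : a <= b ->
  (forall t, a <= t <= b -> is_derive t 1 f (f' t)) ->
  (forall t, a <= t < b -> 0 <= f' t) -> f a <= f b.
Proof.
move=> ab df f'0; have sub t : t \in `]a, b[ -> a <= t <= b.
  by rewrite in_itv/= => /andP[/ltW -> /ltW].
apply: (@ger0_derive1_ndecr R f a b) => //.
- by move=> t /sub /df [].
- move=> t tab; have [_] := df _ (sub _ tab); rewrite derive1E => ->.
  by apply: f'0; move: tab; rewrite in_itv/= => /andP[/ltW -> ->].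
- apply: continuous_in_subspaceT => t; rewrite inE/= in_itv/= => tab.
  exact: is_derive_continuous (df _ tab).
Qed.

(** Continuous induction: a continuous function that is positive wherever it
    has been nonnegative before never vanishes. *)
Lemma continuous_induction g (a : R) : (forall t, a <= t -> {for t, continuous g}) ->
  (forall t, a <= t -> (forall u, a <= u < t -> 0 <= g u) -> 0 < g t) ->
  forall t, a <= t -> 0 < g t.
Proof.
move=> cg step b ab.
pose S := [set t | a <= t <= b /\ forall u, a <= u < t -> 0 <= g u].
have Sa : S a.
  split; first by rewrite lexx.
  by move=> u /andP[au ua]; move: (le_lt_trans au ua); rewrite ltxx.
have hS : has_sup S by split; [exists a|exists b => t [/andP[]]].
set c := sup S.
have ac : a <= c by apply: ub_le_sup => //; case: hS.
have cb : c <= b by apply: ge_sup; [exists a|move=> t [/andP[]]].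
have below u : a <= u < c -> 0 <= g u.
  move=> /andP[au uc]; have [t St ut] := sup_gt (ex_intro _ a Sa) uc.
  by case: St => _; apply; rewrite au.
have gc : 0 < g c by exact: step.
have [ebc|ncb] := eqVneq c b; first by rewrite -ebc.
have cltb : c < b by rewrite lt_neqAle ncb.
have /nbhs_ballP[e /= e0 he] : \forall x \near c, 0 < g x.
  exact: (cvgr_gt (g c) (cg c ac) 0 gc).
pose d := Num.min (c + e / 2) b.
have cd : c < d by rewrite lt_min cltb ltrDl divr_gt0.
suff Sd : S d.
  have : d <= c by apply: ub_le_sup => //; case: hS.
  by rewrite leNgt cd.
split; first by rewrite (le_trans ac (ltW cd)) ge_min lexx orbT.
move=> u /andP[au ud]; have [uc|cu] := ltP u c; first by rewrite below ?au.
apply/ltW/he; rewrite /ball /= ler0_norm ?subr_le0 // opprB.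
move: ud; rewrite lt_min => /andP[ud _]; lra.
Qed.

Lemma expR_ge_pow4 (x : R) : 0 <= x -> x ^+ 4 / 24 <= expR x.
Proof.
by move=> x0; apply: le_trans (expR_ge1Dxn 3 x0); rewrite lerDr.
Qed.

End Calculus.

Lemma antiderivative (R : realType) (f : R -> R) (a : R) :
  (forall t, a <= t -> {for t, continuous f}) ->
  exists F : R -> R, forall t, a < t -> is_derive t 1 F (f t).
Proof.
move=> cf; exists (fun x => \int[lebesgue_measure]_(t in [set` `[a, x]]) f t)%R.
move=> t at_.
have int : lebesgue_measure.-integrable `[a, t + 1] (EFin \o f).
  apply: continuous_compact_integrable; first exact: segment_compact.
  apply: continuous_in_subspaceT => u; rewrite inE/= in_itv/= => /andP[au _].
  exact: cf.
have t1 : t < t + 1 by lra.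
have [h1 h2] := continuous_FTC1_closed t1 int at_ (cf t (ltW at_)).
by split; [exact: h1|rewrite -derive1E].
Qed.

(** * Scalar quantities along a soliton *)

(** Coordinatewise derivative of a curve of column vectors. *)
Definition is_vderive (R : realType) (n : nat) (u : R -> 'cV[R]_n) (s : R)
    (du : 'cV[R]_n) : Prop :=
  forall i, is_derive s 1 (fun t => u t i 0) (du i 0).

Section VectorDerivative.
Context {R : realType} {n : nat}.
Implicit Types (u v : R -> 'cV[R]_n).

Lemma derivable_is_vderive u s : derivable u s 1 -> is_vderive u s (derive1 u s).
Proof.
move=> du i; rewrite derive1E (derive_mx du) mxE.
by apply: derivableP; move/derivable_mxP: du; exact.
Qed.

Lemma is_derive_sum_fun (I : Type) (l : seq I) (f : I -> R -> R) (s : R)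
    (df : I -> R) :
  (forall i, is_derive s 1 (f i) (df i)) ->
  is_derive s 1 (fun t => \sum_(i <- l) f i t) (\sum_(i <- l) df i).
Proof.
move=> hf; elim: l => [|i l IH].
  rewrite big_nil; have -> : (fun t : R => \sum_(i <- [::]) f i t) = (fun=> 0).
    by apply/funext => t; rewrite big_nil.
  exact: is_derive_cst_fun.
rewrite big_cons.
have -> : (fun t : R => \sum_(j <- i :: l) f j t) =
          (fun t => f i t + \sum_(j <- l) f j t).
  by apply/funext => t; rewrite big_cons.
exact: is_deriveD_fun.
Qed.

Lemma is_derive_dotv u v s du dv : is_vderive u s du -> is_vderive v s dv ->
  is_derive s 1 (fun t => dotv (u t) (v t)) (dotv du (v s) + dotv (u s) dv).
Proof.
move=> hu hv; rewrite /dotv -big_split /=.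
by apply: is_derive_sum_fun => i; exact: is_deriveM_fun.
Qed.

Lemma is_vderive_mulmx (M : 'M[R]_n) u s du : is_vderive u s du ->
  is_vderive (fun t => M *m u t) s (M *m du).
Proof.
move=> hu i; rewrite mxE.
have -> : (fun t => (M *m u t) i 0) = (fun t => \sum_j M i j * u t j 0).
  by apply/funext => t; rewrite mxE.
by apply: is_derive_sum_fun => j; exact: is_deriveZ_fun.
Qed.

End VectorDerivative.

Section ScalarQuantities.
Context {R : realType} {n : nat} (alpha : R) (A : 'M[R]_n) (C : R -> 'cV[R]_n).
Context (A_anti : A^T = - A) (C_soliton : soliton alpha A C).
Implicit Types s : R.

(** The tangent vector, and the squared lengths of C and A C. *)
Definition tang s := derive1 C s.
Definition sqC s := dotv (C s) (C s).
Definition sqAC s := dotv (A *m C s) (A *m C s).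

(** Inner products of the vectors C, T, A C and A T. *)
Definition dotCT s := dotv (C s) (tang s).
Definition dotTAC s := dotv (tang s) (A *m C s).
Definition dotACAT s := dotv (A *m C s) (A *m tang s).

(** With a = (alpha + A) C: the squared length of a, its tangential component,
    its normal component [curv] (which is the curvature vector of the soliton),
    the squared length of the latter, and its inner product with A T. *)
Definition sqa s := dotv (avec alpha A (C s)) (avec alpha A (C s)).
Definition tana s := dotv (avec alpha A (C s)) (tang s).
Definition curv s := avec alpha A (C s) - tana s *: tang s.
Definition sqcurv s := sqa s - tana s ^+ 2.
Definition dotATcurv s := dotv (A *m tang s) (curv s).

Lemma avecE u : avec alpha A u = alpha *: u + A *m u.
Proof. by rewrite /avec mulmxDl mul_scalar_mx. Qed.

Lemma dotv_AA u : dotv u (A *m u) = 0.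
Proof. exact: dotv_anti. Qed.

Lemma dotv_tang s : dotv (tang s) (tang s) = 1.
Proof. by have [_ h _ _] := C_soliton s; rewrite -enorm_sqr h expr1n. Qed.

Lemma is_vderiveC s : is_vderive C s (tang s).
Proof. by have [h _ _ _] := C_soliton s; exact: derivable_is_vderive. Qed.

Lemma is_vderive_tang s : is_vderive tang s (curv s).
Proof.
have [_ h1 h e] := C_soliton s; have := derivable_is_vderive h.
by rewrite e /orthproj h1 expr1n divr1.
Qed.

Lemma sqaE s : sqa s = alpha ^+ 2 * sqC s + sqAC s.
Proof.
rewrite /sqa avecE dotvDl !dotvDr !dotvZl !dotvZr.
by rewrite (dotvC (A *m _)) dotv_AA -/(sqC s) -/(sqAC s); ring.
Qed.

Lemma tanaE s : tana s = alpha * dotCT s + dotTAC s.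
Proof. by rewrite /tana avecE dotvDl dotvZl (dotvC (A *m _)). Qed.

Lemma dotv_curvr u s :
  dotv u (curv s) = dotv u (avec alpha A (C s)) - tana s * dotv u (tang s).
Proof. by rewrite /curv dotvBr dotvZr. Qed.

Lemma dotv_curv s : dotv (curv s) (curv s) = sqcurv s.
Proof.
rewrite dotv_curvr {1 2}/curv dotvBl dotvBl !dotvZl dotv_tang.
by rewrite (dotvC (tang s)) -/(tana s) -/(sqa s) /sqcurv; ring.
Qed.

Lemma sqcurv_ge0 s : 0 <= sqcurv s.
Proof. by rewrite -dotv_curv dotv_ge0. Qed.

Lemma sqC_ge0 s : 0 <= sqC s. Proof. exact: dotv_ge0. Qed.
Lemma sqAC_ge0 s : 0 <= sqAC s. Proof. exact: dotv_ge0. Qed.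

Lemma dotCT_sqr s : dotCT s ^+ 2 <= sqC s.
Proof. by apply: le_trans (dotv_CS _ _) _; rewrite dotv_tang mulr1. Qed.

Lemma dotTAC_sqr s : dotTAC s ^+ 2 <= sqAC s.
Proof. by apply: le_trans (dotv_CS _ _) _; rewrite dotv_tang mul1r. Qed.

Lemma dotv_curvC s : dotv (C s) (curv s) = alpha * sqC s - tana s * dotCT s.
Proof. by rewrite dotv_curvr avecE dotvDr dotvZr dotv_AA addr0. Qed.

Lemma dotv_curvAC s : dotv (A *m C s) (curv s) = sqAC s - tana s * dotTAC s.
Proof.
by rewrite dotv_curvr avecE dotvDr dotvZr dotvC dotv_AA mulr0 add0r (dotvC _ (tang s)).
Qed.

Lemma dotv_curvA s :
  dotv (A *m C s) (A *m curv s) = alpha * sqAC s - tana s * dotACAT s.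
Proof.
rewrite /curv mulmxBr -scalemxAr dotvBr dotvZr; congr (_ - _).
by rewrite avecE mulmxDr -scalemxAr dotvDr dotvZr dotv_AA addr0.
Qed.

Lemma curvC_sqr s : (alpha * sqC s - tana s * dotCT s) ^+ 2 <= sqcurv s * sqC s.
Proof. by rewrite -dotv_curvC -dotv_curv mulrC dotv_CS. Qed.

Lemma curvAC_sqr s : (sqAC s - tana s * dotTAC s) ^+ 2 <= sqcurv s * sqAC s.
Proof. by rewrite -dotv_curvAC -dotv_curv mulrC dotv_CS. Qed.

Lemma is_derive_sqC s : is_derive s 1 sqC (2 * dotCT s).
Proof.
have h := is_vderiveC s; apply: is_derive_eq (is_derive_dotv h h) _.
by rewrite (dotvC (tang s)) -/(dotCT s); ring.
Qed.

Lemma is_derive_sqAC s : is_derive s 1 sqAC (2 * dotACAT s).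
Proof.
have h := is_vderive_mulmx A (is_vderiveC s).
apply: is_derive_eq (is_derive_dotv h h) _.
by rewrite (dotvC (A *m tang s)) -/(dotACAT s); ring.
Qed.

Lemma is_derive_dotTAC s :
  is_derive s 1 dotTAC (sqAC s - tana s * dotTAC s).
Proof.
have h := is_vderive_mulmx A (is_vderiveC s).
apply: is_derive_eq (is_derive_dotv (is_vderive_tang s) h) _.
by rewrite dotv_AA addr0 dotvC dotv_curvAC.
Qed.

Lemma is_derive_tana s : is_derive s 1 tana (alpha + sqcurv s).
Proof.
have h := is_vderive_mulmx (alpha%:M + A) (is_vderiveC s).
apply: is_derive_eq (is_derive_dotv h (is_vderive_tang s)) _.
rewrite -/(avec alpha A (tang s)) -/(avec alpha A (C s)) dotv_curvr -/(sqa s).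
rewrite -/(tana s) avecE dotvDl dotvZl dotv_tang (dotvC (A *m _)) dotv_AA.
by rewrite /sqcurv; ring.
Qed.

Lemma is_derive_sqcurv s :
  is_derive s 1 sqcurv (2 * dotATcurv s - 2 * tana s * sqcurv s).
Proof.
have h := is_vderive_mulmx (alpha%:M + A) (is_vderiveC s).
have ha := is_derive_tana s.
have -> : sqcurv = (fun t => sqa t - tana t * tana t).
  by apply/funext => t; rewrite /sqcurv expr2.
apply: is_derive_eq (is_deriveB_fun (is_derive_dotv h h) (is_deriveM_fun ha ha)) _.
rewrite -/(avec alpha A (tang s)) -/(avec alpha A (C s)).
rewrite (dotvC (avec alpha A (C s)) (avec _ _ _)) [avec _ _ (tang s)]avecE.
rewrite dotvDl dotvZl (dotvC (tang s)) -/(tana s) /dotATcurv dotv_curvr.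
by rewrite (dotvC (A *m tang s) (tang s)) dotv_AA /sqcurv; ring.
Qed.

(** Here N bounds the squared operator norm of A. *)
Section OperatorBound.
Context (N : R) (A_bound : forall u, dotv (A *m u) (A *m u) <= N * dotv u u).

Lemma sqAC_le s : sqAC s <= N * sqC s.
Proof. exact: A_bound. Qed.

Lemma curvA_sqr s : 
  (alpha * sqAC s - tana s * dotACAT s) ^+ 2 <= sqAC s * (N * sqcurv s).
Proof.
rewrite -dotv_curvA -dotv_curv; apply: le_trans (dotv_CS _ _) _.
by rewrite ler_wpM2l ?sqAC_ge0.
Qed.

Lemma dotACAT_sqr s : dotACAT s ^+ 2 <= N * sqAC s.
Proof.
apply: le_trans (dotv_CS _ _) _; rewrite mulrC ler_wpM2r ?sqAC_ge0 //.
by rewrite (le_trans (A_bound _)) // dotv_tang mulr1.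
Qed.

Lemma dotATcurv_sqr s : dotATcurv s ^+ 2 <= N * sqcurv s.
Proof.
apply: le_trans (dotv_CS _ _) _; rewrite dotv_curv ler_wpM2r ?sqcurv_ge0 //.
by rewrite (le_trans (A_bound _)) // dotv_tang mulr1.
Qed.

End OperatorBound.
End ScalarQuantities.

(** * The scalar system *)

Section Gronwall.
Context {R : realType}.
Implicit Types (f df : R -> R) (a b l : R).

Lemma gronwall_ge f df a b l : a <= b ->
  (forall t, a <= t <= b -> is_derive t 1 f (df t)) ->
  (forall t, a <= t <= b -> l * f t <= df t) ->
  expR (l * (b - a)) * f a <= f b.
Proof.
move=> ab hf hdf.
pose g t := expR (- l * t) * f t.
have : g a <= g b.
  apply: (derive_ge0_le (f' := fun t => expR (- l * t) * (df t - l * f t)) ab).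
    move=> t tab; have h1 := is_deriveZ_fun (- l) (is_derive_id t (1 : R)).
    apply: is_derive_eq (is_deriveM_fun (is_derive_expR_fun h1) (hf t tab)) _.
    by rewrite mulr1; ring.
  move=> t /andP[at_ tb]; rewrite mulr_ge0 ?expR_ge0 // subr_ge0 hdf //.
  by rewrite at_ ltW.
rewrite -(ler_pM2l (expR_gt0 (l * b))) /g !mulrA -!expRD.
rewrite (_ : l * b + - l * a = l * (b - a)); last by ring.
by rewrite (_ : l * b + - l * b = 0) ?expR0 ?mul1r //; ring.
Qed.

Lemma gronwall_le f df a b l : a <= b ->
  (forall t, a <= t <= b -> is_derive t 1 f (df t)) ->
  (forall t, a <= t <= b -> df t <= l * f t) ->
  f b <= expR (l * (b - a)) * f a.
Proof.
move=> ab hf hdf.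
have := @gronwall_ge (fun t => - f t) (fun t => - df t) a b l ab.
rewrite mulrN lerN2; apply; first by move=> t /hf h; exact: is_deriveN.
by move=> t /hdf h; rewrite mulrN lerN2.
Qed.

Lemma expR_le4 (x : R) : x <= 1 -> expR x <= 4.
Proof.
move=> x1; have h2 : 2^-1 <= expR (- (2^-1)) :> R.
  by apply: le_trans (expR_ge1Dx _); lra.
have -> : x = x - 1 + 2^-1 + 2^-1 by field.
have e0 := expR_gt0 (2^-1 : R).
have he : expR (2^-1) <= 2 :> R.
  by rewrite -[2^-1]opprK expRN -[leRHS]invrK lef_pV2 // posrE ?invr_gt0 // expR_gt0.
have h1 : expR (x - 1) <= 1 by rewrite -[leRHS]expR0 ler_expR subr_le0.
have h0 := expR_gt0 (x - 1).
move: (x - 1) h1 h0 => y h1 h0; rewrite !expRD.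
have h2e : expR (2^-1) * expR (2^-1) <= 2 * 2 :> R.
  by rewrite ler_pM // ltW.
rewrite -mulrA; apply: (@le_trans _ _ (1 * (2 * 2))); last by lra.
by rewrite ler_pM ?mulr_ge0 // ltW.
Qed.

End Gronwall.

Lemma sqr_le_itv (R : realType) (x y : R) : 0 <= y -> x ^+ 2 <= y ^+ 2 ->
  - y <= x /\ x <= y.
Proof.
move=> y0 h; apply/andP; rewrite -ler_norml -(ger0_norm y0).
by rewrite -ler_sqr ?nnegrE // !real_normK ?num_real.
Qed.

(** The relations between the scalar quantities of a soliton with |A v|^2 <=
    N |v|^2 from which its asymptotics follow: r = |C|^2, w = |A C|^2,
    p = <C, T>, q = <T, A C>, x = <A C, A T>, while m, k and e are the tangential
    component of a = (alpha + A) C, the squared length of its normal component b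
    and <A T, b>.  The last three inequalities say that b is small in the
    directions of C, A C and A^2 C when k is small. *)
Record scalar_soliton (R : realType) (alpha N : R) (r w p q m k x e : R -> R) : Prop :=
  ScalarSoliton {
    ss_alpha : alpha < 0;
    ss_N : 0 < N;
    ss_r : forall s : R, 0 <= r s;
    ss_w : forall s : R, 0 <= w s;
    ss_k : forall s : R, 0 <= k s;
    ss_wr : forall s : R, w s <= N * r s;
    ss_mE : forall s : R, m s = alpha * p s + q s;
    ss_kE : forall s : R, k s = alpha ^+ 2 * r s + w s - m s ^+ 2;
    ss_p : forall s : R, p s ^+ 2 <= r s;
    ss_q : forall s : R, q s ^+ 2 <= w s;
    ss_x : forall s : R, x s ^+ 2 <= N * w s;
    ss_e : forall s : R, e s ^+ 2 <= N * k s;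
    ss_dr : forall s : R, is_derive s 1 r (2 * p s);
    ss_dw : forall s : R, is_derive s 1 w (2 * x s);
    ss_dq : forall s : R, is_derive s 1 q (w s - m s * q s);
    ss_dm : forall s : R, is_derive s 1 m (alpha + k s);
    ss_dk : forall s : R, is_derive s 1 k (2 * e s - 2 * m s * k s);
    ss_bC : forall s : R, (alpha * r s - m s * p s) ^+ 2 <= k s * r s;
    ss_bAC : forall s : R, (w s - m s * q s) ^+ 2 <= k s * w s;
    ss_bA2C : forall s : R, (alpha * w s - m s * x s) ^+ 2 <= w s * (N * k s)
  }.

Section ScalarSoliton.
Context {R : realType} {alpha N : R} {r w p q m k x e : R -> R}.
Context (S : scalar_soliton alpha N r w p q m k x e).
Implicit Types s t : R.

Let N0 : 0 < N. Proof. by case: S. Qed.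

(** Over one unit of arc length r + 1 at most quadruples, and w + N is at most
    divided by 4. *)
Lemma sqC_unit_le s t : s <= t <= s + 1 -> r t + 1 <= 4 * (r s + 1).
Proof.
move=> /andP[st ts].
have h : r t + 1 <= expR (1 * (t - s)) * (r s + 1).
  apply: (gronwall_le (f := fun u => r u + 1) (df := fun u => 2 * p u + 0)) => //.
    by move=> u _; exact: is_deriveD_fun (ss_dr S u) (is_derive_cst_fun _ _).
  by move=> u _; have := ss_p S u; have := sqr_ge0 (p u - 1); nra.
have e4 : expR (1 * (t - s)) <= 4 by apply: expR_le4; lra.
apply: le_trans h _; rewrite ler_wpM2r //.
by have := ss_r S s; lra.
Qed.

Lemma sqAC_exp_ge s t : s <= t -> expR (-1 * (t - s)) * (w s + N) <= w t + N.
Proof.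
move=> st.
apply: (gronwall_ge (f := fun u => w u + N) (df := fun u => 2 * x u + 0)) => //.
  by move=> u _; exact: is_deriveD_fun (ss_dw S u) (is_derive_cst_fun _ _).
move=> u _; rewrite mulN1r addr0.
have hx := ss_x S u; have hw := ss_w S u.
have h4 : (2 * x u) ^+ 2 <= (w u + N) ^+ 2.
  by have := sqr_ge0 (w u - N); nra.
have wN : 0 <= w u + N by have := N0; lra.
by have [h _] := sqr_le_itv wN h4; lra.
Qed.

Lemma sqAC_unit_ge s t : s <= t <= s + 1 -> (w s + N) / 4 <= w t + N.
Proof.
move=> /andP[st ts].
have e4 : 4^-1 <= expR (-1 * (t - s)).
  rewrite mulN1r expRN lef_pV2 ?posrE ?expR_gt0 //; apply: expR_le4; lra.
apply: le_trans (sqAC_exp_ge st); rewrite mulrC ler_wpM2r //.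
by have := ss_w S s; have := N0; lra.
Qed.

Lemma sqa_ge_sqAC s : w s <= k s + m s ^+ 2.
Proof.
by rewrite (ss_kE S) subrK lerDr mulr_ge0 ?sqr_ge0 // (ss_r S).
Qed.

Lemma tana_sqr_le s : m s ^+ 2 <= (alpha ^+ 2 + N) * r s.
Proof. by have := ss_kE S s; have := ss_k S s; have := ss_wr S s; lra. Qed.

Lemma sqcurv_le s : k s <= (alpha ^+ 2 + N) * r s.
Proof. by have := ss_kE S s; have := sqr_ge0 (m s); have := ss_wr S s; lra. Qed.

Context (q_le0 : forall s, q s <= 0).

(** If T points to the side of a, then T is far from a: otherwise
    <T, A C> would be close to |A C|^2 / |a|, which is positive. *)
Lemma sqcurv_ge_sqAC s : 0 <= m s -> w s <= k s.
Proof.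
move=> m0; have [w0|w0] := eqVneq (w s) 0; first by rewrite w0 (ss_k S).
have wp : 0 < w s by rewrite lt_def w0 (ss_w S).
have h := ss_bAC S s; have mq : m s * q s <= 0 by rewrite mulr_ge0_le0.
by rewrite -(ler_pM2r wp); nra.
Qed.

End ScalarSoliton.

(** * The bound on the normal component *)

Section CurvatureBound.
Context {R : realType} {alpha N : R} {r w p q m k x e : R -> R}.
Context (S : scalar_soliton alpha N r w p q m k x e).
Context (q_le0 : forall s, q s <= 0).
Implicit Types s t : R.

(** The logarithmic derivative of k exp(l m) is - 2 m + l (k + alpha), up to the
    term 2 <A T, b> / k.  On the next unit of arc length it is at least of order
    d = |C(s)|, whatever the sign of m: where m < 0 the normal component is
    repelled from 0, and where m >= 0 the factor exp(l m) grows. *)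
Lemma growth_rate (c h g L d l : R) s t : 0 < c -> 1 <= d -> 0 < h -> 0 < L -> 0 < g ->
  8 * (alpha ^+ 2 + N) <= h ^+ 2 -> g * (8 * h) = c -> l * d = L ->
  2 * h + 2 * g <= L * c / 8 -> 2 <= L * h ->
  8 * N <= c * d ^+ 2 -> L * (- alpha) <= g * d ^+ 2 ->
  c * r s <= w s -> r s = d ^+ 2 -> s <= t <= s + 1 ->
  [/\ - (h * d) <= m t <= h * d, k t <= h ^+ 2 * d ^+ 2 &
      g * d <= - 2 * m t + l * (k t + alpha)].
Proof.
move=> c0 d1 h0 L0 g0 hh gh ld L1 L2 dN dL wr rd st.
have d0 : 0 < d by lra.
have l0 : 0 < l by rewrite -(pmulr_lgt0 _ d0) ld.
have d2 : 1 <= d ^+ 2 by rewrite exprn_ege1.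
have Q0 : 0 <= alpha ^+ 2 + N by rewrite addr_ge0 ?sqr_ge0 // ltW // (ss_N S).
have rt : r t <= 8 * d ^+ 2 by have := sqC_unit_le S st; rewrite rd; lra.
have wt : c * d ^+ 2 / 8 <= w t.
  by have := sqAC_unit_ge S st; have := ss_N S; move: wr; rewrite rd; lra.
have hd : (alpha ^+ 2 + N) * r t <= h ^+ 2 * d ^+ 2.
  apply: (@le_trans _ _ ((alpha ^+ 2 + N) * (8 * d ^+ 2))); first by rewrite ler_wpM2l.
  by rewrite mulrA ler_wpM2r ?sqr_ge0 //; lra.
have hd0 : 0 <= h * d by rewrite mulr_ge0 // ltW.
have [m1 m2] : - (h * d) <= m t /\ m t <= h * d.
  by apply: sqr_le_itv => //; rewrite exprMn; apply: le_trans hd; exact: tana_sqr_le S t.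
have k2 := le_trans (sqcurv_le S t) hd.
have k0 := ss_k S t.
split=> //; first by rewrite m1.
have la : - (g * d) <= l * alpha.
  rewrite -(ler_pM2r d0).
  have -> : l * alpha * d = L * alpha by rewrite -ld; ring.
  by move: dL; rewrite expr2; lra.
suff : 2 * (g * d) <= - 2 * m t + l * k t by lra.
(* Either m >= 0, and l k >= l w dominates; or m < 0, and since |m| <= h d and
   m^2 + k >= w, one of - m and l k is of order d. *)
have [mt|mt] := leP 0 (m t).
  have wk := sqcurv_ge_sqAC S q_le0 mt.
  have : l * (c * d ^+ 2 / 8) <= l * k t by rewrite ler_pM2l //; exact: le_trans wk.
  have -> : l * (c * d ^+ 2 / 8) = (L * c / 8) * d by rewrite -ld; field.
  have : (2 * h + 2 * g) * d <= (L * c / 8) * d by rewrite ler_pM2r.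
  by lra.
have hdp : 0 < h * d by rewrite mulr_gt0.
rewrite -(ler_pM2l hdp).
have e1 : m t ^+ 2 <= h * d * (- m t).
  by rewrite expr2 -mulrNN ler_wpM2r //; lra.
have e2 : 2 * k t <= h * d * (l * k t).
  have -> : h * d * (l * k t) = (L * h) * k t by rewrite -ld; ring.
  by rewrite ler_wpM2r.
have e3 := sqa_ge_sqAC S t.
have e4 : h * d * (2 * (g * d)) = 2 * (c * d ^+ 2 / 8).
  by rewrite -gh; field.
by rewrite e4 mulrDr; lra.
Qed.

(** Where |C| is large and A C is not small compared to C, the tangent points away
    from a, up to an error of order 1 / |C|^2.  If the normal component were larger
    at s, its growth over the next unit of arc length would exceed |a|. *)
Lemma curvature_bound (c : R) : 0 < c -> exists K R0 : R, [/\ 0 < K, 1 <= R0 &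
  forall s, c * r s <= w s -> R0 <= r s -> m s < 0 /\ k s * r s <= K].
Proof.
move=> c0; have N0 := ss_N S; have a0 := ss_alpha S.
pose Q := alpha ^+ 2 + N; have Q0 : 0 < Q by rewrite ltr_wpDl ?sqr_ge0.
(* h, g and L are chosen to satisfy the hypotheses of growth_rate. *)
pose h := 8 * Q + 1; have h1 : 1 < h by rewrite /h; lra.
have hh : 8 * Q <= h ^+ 2 by rewrite expr2 /h; nra.
clearbody h; have h0 : 0 < h by lra.
have hn := lt0r_neq0 h0; have cn := lt0r_neq0 c0.
pose g : R := c / (8 * h); have g0 : 0 < g by rewrite divr_gt0 //; lra.
have gn := lt0r_neq0 g0.
have gh : g * (8 * h) = c by rewrite /g; field.
clearbody g.
pose L := 8 * (2 * h + 2 * g) / c + 2 / h.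
have L1 : 2 * h + 2 * g <= L * c / 8.
  have -> : L * c / 8 = (2 * h + 2 * g) + c / (4 * h).
    by rewrite /L; field; rewrite ?cn ?hn.
  by rewrite lerDl divr_ge0 //; lra.
have L2 : 2 <= L * h.
  have -> : L * h = 2 + h * (8 * (2 * h + 2 * g) / c).
    by rewrite /L; field; rewrite ?cn ?hn.
  by rewrite lerDl mulr_ge0 ?divr_ge0 //; lra.
clearbody L; have L0 : 0 < L by rewrite -(pmulr_lgt0 _ h0); lra.
pose E := expR (L * h); have E0 : 0 < E by exact: expR_gt0.
pose K' := E * (4 * N / g ^+ 2 + 24 * 16 * h ^+ 2 / g ^+ 4).
pose K := E * K'.
have K'0 : 0 < K'.
  rewrite mulr_gt0 // addr_gt0 // divr_gt0 ?exprn_gt0 //; first by lra.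
  by rewrite !mulr_gt0 ?exprn_gt0 // ltr0n.
have K0 : 0 < K by rewrite mulr_gt0.
pose R0 := 1 + K / c + 8 * N / c + L * (- alpha) / g.
have t1 : 0 < K / c by rewrite divr_gt0.
have t2 : 0 < 8 * N / c by rewrite divr_gt0 //; lra.
have t3 : 0 < L * (- alpha) / g by rewrite divr_gt0 // mulr_gt0 ?oppr_gt0.
exists K, R0; split => //; first by rewrite /R0; lra.
move=> s wr rR; suff kr : k s * r s <= K.
  split=> //; rewrite ltNge; apply/negP => ms.
  have wk := le_trans wr (sqcurv_ge_sqAC S q_le0 ms).
  have r1 : 1 + K / c <= r s by apply: le_trans rR; rewrite /R0; lra.
  have : c * r s * r s <= K by apply: le_trans kr; rewrite ler_wpM2r ?(ss_r S).
  have r1' : 1 <= r s by lra.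
  have : c * (1 + K / c) <= c * r s * r s.
    rewrite -mulrA ler_pM2l //; apply: le_trans r1 _.
    by rewrite ler_peMl //; exact: (ss_r S).
  have -> : c * (1 + K / c) = c + K by field.
  by lra.
have rs1 : 1 <= r s by apply: le_trans rR; rewrite /R0; lra.
pose d := Num.sqrt (r s).
have d2 : r s = d ^+ 2 by rewrite sqr_sqrtr // (ss_r S).
have d1 : 1 <= d by rewrite -[1]sqrtr1 ler_wsqrtr.
have d0 : 0 < d by lra.
have dn := lt0r_neq0 d0.
pose l := L / d; have ld : l * d = L by rewrite /l divfK.
have dN : 8 * N <= c * d ^+ 2.
  by rewrite -d2 [c * _]mulrC -ler_pdivrMr //; apply: le_trans rR; rewrite /R0; lra.
have dL : L * (- alpha) <= g * d ^+ 2.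
  by rewrite -d2 [g * _]mulrC -ler_pdivrMr //; apply: le_trans rR; rewrite /R0; lra.
have rate t (st : s <= t <= s + 1) :=
  growth_rate c0 d1 h0 L0 g0 hh gh ld L1 L2 dN dL wr d2 st.
(* F is at most of order d^2, and it grows at the exponential rate rho apart from
   an error of order 1 / d coming from <A T, b>. *)
pose F t := expR (l * m t) * k t.
pose rho := g * d / 2.
have rho0 : 0 < rho by rewrite /rho divr_gt0 // mulr_gt0.
have rhon := lt0r_neq0 rho0.
have lm t : s <= t <= s + 1 -> E^-1 <= expR (l * m t) <= E.
  move=> /rate[/andP[m1 m2] _ _]; rewrite /E -expRN !ler_expR.
  have l0 : 0 <= l by rewrite /l divr_ge0 // ltW.
  have := ler_wpM2l l0 m1; have := ler_wpM2l l0 m2.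
  have -> : l * - (h * d) = - (L * h) by rewrite -ld; ring.
  have -> : l * (h * d) = L * h by rewrite -ld; ring.
  by move=> -> ->.
pose dF t := (l * (alpha + k t) * expR (l * m t)) * k t
             + expR (l * m t) * (2 * e t - 2 * m t * k t).
(* E N / rho^2 is the equilibrium of the differential inequality for F. *)
have growth : expR (rho * (s + 1 - s)) * (F s - E * N / rho ^+ 2) <=
              F (s + 1) - E * N / rho ^+ 2.
  apply: (gronwall_ge (f := fun t => F t - E * N / rho ^+ 2)
                      (df := fun t => dF t - 0)); first by lra.
    move=> t _; apply: is_deriveB_fun (is_derive_cst_fun _ _).
    apply: is_deriveM_fun (ss_dk S t).
    exact: is_derive_expR_fun (is_deriveZ_fun l (ss_dm S t)).
  move=> t st; have [_ _ rt] := rate t st; have /andP[_ mE] := lm t st.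
  have k0 := ss_k S t.
  have e1 : - (2 * e t) <= rho * k t + N / rho.
    have s0 : 0 <= rho * k t + N / rho by rewrite addr_ge0 ?mulr_ge0 ?invr_ge0 // ltW.
    have /(sqr_le_itv s0)[] : (2 * e t) ^+ 2 <= (rho * k t + N / rho) ^+ 2.
      have -> : (rho * k t + N / rho) ^+ 2 = (rho * k t - N / rho) ^+ 2 + 4 * (N * k t).
        by field.
      by have := ss_e S t; have := sqr_ge0 (rho * k t - N / rho); nra.
    by lra.
  have key : rho * k t - N / rho <= l * (alpha + k t) * k t + (2 * e t - 2 * m t * k t).
    have := ler_wpM2r k0 rt.
    have -> : g * d = 2 * rho by rewrite /rho; field.
    by lra.
  rewrite subr0 /F /dF.
  have e0 := expR_gt0 (l * m t).
  apply: (@le_trans _ _ (expR (l * m t) * (rho * k t - N / rho))); last first.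
    suff -> : l * (alpha + k t) * expR (l * m t) * k t +
        expR (l * m t) * (2 * e t - 2 * m t * k t) = expR (l * m t) *
        (l * (alpha + k t) * k t + (2 * e t - 2 * m t * k t)) by rewrite ler_pM2l.
    by ring.
  have -> : rho * (expR (l * m t) * k t - E * N / rho ^+ 2) =
     expR (l * m t) * (rho * k t) - E * (N / rho) by field.
  rewrite mulrBr lerD2l lerN2 ler_wpM2r // divr_ge0 // ltW //.
have s1 : s <= s + 1 <= s + 1 by rewrite lexx andbT; lra.
have s0 : s <= s <= s + 1 by rewrite lexx /=; lra.
have Fs1 : F (s + 1) <= E * (h ^+ 2 * d ^+ 2).
  have /andP[_ mE] := lm _ s1; have [_ k2 _] := rate _ s1.
  by rewrite /F ler_pM ?expR_ge0 ?(ss_k S).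
have Fs : (F s - E * N / rho ^+ 2) * d ^+ 2 <= 24 * 16 * h ^+ 2 / g ^+ 4 * E.
  have [neg|pos] := leP (F s - E * N / rho ^+ 2) 0.
    apply: (@le_trans _ _ 0); first by rewrite mulr_le0_ge0 ?sqr_ge0.
    by rewrite mulr_ge0 ?divr_ge0 ?mulr_ge0 ?exprn_ge0 // ltW.
  (* A quartic lower bound of exp(rho) beats the bound d^2 for F, leaving 1 / d^2. *)
  have p4 := expR_ge_pow4 (ltW rho0).
  have En : 0 <= E * N / rho ^+ 2 by rewrite divr_ge0 ?mulr_ge0 ?sqr_ge0 // ltW.
  move: growth; rewrite (_ : rho * (s + 1 - s) = rho); last by ring.
  move=> growth.
  have : rho ^+ 4 / 24 * (F s - E * N / rho ^+ 2) <= E * (h ^+ 2 * d ^+ 2).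
    apply: le_trans (ler_wpM2r (ltW pos) p4) _; lra.
  have c0' : 0 < (24 * 16) / (g ^+ 4 * d ^+ 2) by rewrite divr_gt0 ?mulr_gt0 ?exprn_gt0.
  move/(ler_wpM2l (ltW c0')).
  have -> : (24 * 16) / (g ^+ 4 * d ^+ 2) * (rho ^+ 4 / 24 * (F s - E * N / rho ^+ 2)) =
    (F s - E * N / rho ^+ 2) * d ^+ 2.
    move: (F s - E * N / rho ^+ 2) => Y; rewrite /rho; by field; rewrite ?gn ?dn.
  suff -> : (24 * 16) / (g ^+ 4 * d ^+ 2) * (E * (h ^+ 2 * d ^+ 2)) =
    24 * 16 * h ^+ 2 / g ^+ 4 * E by [].
  by field; rewrite ?gn ?dn.
have FsK : F s * d ^+ 2 <= K'.
  have : E * N / rho ^+ 2 * d ^+ 2 = 4 * N / g ^+ 2 * E.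
    by rewrite /rho; field; rewrite ?gn ?dn.
  by move: Fs; rewrite mulrBl /K'; lra.
rewrite d2; apply: (@le_trans _ _ (E * (F s * d ^+ 2))); last by rewrite ler_pM2l.
have /andP[mE _] := lm _ s0.
have e1 : 1 <= E * expR (l * m s).
  by rewrite -(ler_pM2l (_ : 0 < E^-1)) ?invr_gt0 // mulr1 mulKf // lt0r_neq0.
have -> : E * (F s * d ^+ 2) = E * expR (l * m s) * (k s * d ^+ 2) by rewrite /F; ring.
by rewrite ler_peMl // mulr_ge0 ?sqr_ge0 ?(ss_k S).
Qed.

End CurvatureBound.

(** * Persistence of the asymptotic regime *)

Section Persistence.
Context {R : realType} {alpha N : R} {r w p q m k x e : R -> R}.
Context (S : scalar_soliton alpha N r w p q m k x e).
Context (q_le0 : forall s, q s <= 0).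
Implicit Types s t : R.

(** Where T is close to - a / |a|, the radius grows, and w / r changes so slowly
    in comparison that (w - L) / r is nondecreasing, with L = 4 N kap / |alpha|:
    the last expression has the sign of its derivative. *)
Lemma radial_growth (K kap : R) t : 0 < K -> K <= kap ^+ 2 -> 0 <= kap ->
  m t < 0 -> k t * r t <= K -> 1 <= r t -> 4 * K <= alpha ^+ 2 * r t ->
  [/\ - alpha / 2 * r t <= - m t * p t, 0 < p t,
      (alpha * r t - m t * p t) ^+ 2 <= K &
      0 <= x t * r t - p t * (w t - 4 * N * kap / - alpha)].
Proof.
move=> K0 Kk k0 mt kr r1 rK; have a0 := ss_alpha S; have N0 := ss_N S.
have y2 := le_trans (ss_bC S t) kr.
have r0 : 0 < r t by lra.
have [y1 _] : - (- alpha / 2 * r t) <= alpha * r t - m t * p t /\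
              alpha * r t - m t * p t <= - alpha / 2 * r t.
  apply: sqr_le_itv; first by rewrite mulr_ge0; lra.
  apply: (le_trans y2).
  have -> : (- alpha / 2 * r t) ^+ 2 = (alpha ^+ 2 * r t) * r t / 4 by field.
  have : alpha ^+ 2 * r t * 1 <= alpha ^+ 2 * r t * r t.
    by rewrite ler_wpM2l // mulr_ge0 ?sqr_ge0 // ltW.
  by lra.
have [y3 y4] := sqr_le_itv k0 (le_trans y2 Kk).
have mp : - alpha / 2 * r t <= - m t * p t by rewrite mulNr; lra.
have p0 : 0 < p t.
  rewrite -(pmulr_rgt0 _ (_ : 0 < - m t)); last by lra.
  by apply: lt_le_trans mp; rewrite mulr_gt0 //; lra.
split=> //; rewrite -(pmulr_rge0 _ (_ : 0 < - m t)); last by lra.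
have Nk0 : 0 <= N * kap by rewrite mulr_ge0 // ltW.
have [v1 v2] : - (N * kap) <= alpha * w t - m t * x t /\
              alpha * w t - m t * x t <= N * kap.
  apply: sqr_le_itv => //; apply: (le_trans (ss_bA2C S t)).
  have h1 : w t * (N * k t) <= N * r t * (N * k t).
    by rewrite ler_wpM2r ?(ss_wr S) // mulr_ge0 ?(ss_k S) // ltW.
  apply: (le_trans h1).
  have -> : N * r t * (N * k t) = N ^+ 2 * (k t * r t) by ring.
  by rewrite exprMn ler_wpM2l ?sqr_ge0 // (le_trans kr).
have h1 : - (N * kap * r t) <= (alpha * w t - m t * x t) * r t.
  by rewrite -mulNr ler_pM2r.
have h2 : (alpha * r t - m t * p t) * w t <= kap * (N * r t).
  apply: (@le_trans _ _ (kap * w t)); first by rewrite ler_wpM2r ?(ss_w S).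
  by rewrite ler_wpM2l ?(ss_wr S).
have Lk : 0 <= 4 * N * kap / - alpha by rewrite divr_ge0 ?oppr_ge0 ?(ltW a0) //; lra.
have h3 := ler_wpM2l Lk mp.
have e3 : 4 * N * kap / - alpha * (- alpha / 2 * r t) = 2 * (N * kap * r t).
  by field; rewrite lt_eqF.
rewrite e3 in h3; move: h1 h2 h3.
set Y := 4 * N * kap / - alpha; lra.
Qed.

(** Once |C| is large and A C is not small compared to C, this remains so. *)
Lemma persistence (c0 : R) : 0 < c0 ->
  (forall R1, exists s, R1 <= r s /\ c0 * r s <= w s) ->
  exists c K s0 : R, [/\ 0 < c, 0 < K &
    forall t, s0 <= t -> [/\ c * r t <= w t, 1 <= r t, m t < 0, k t * r t <= K &
      [/\ - alpha / 2 * r t <= - m t * p t, 0 < p t &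
          (alpha * r t - m t * p t) ^+ 2 <= K]]].
Proof.
move=> c00 often; have a0 := ss_alpha S; have N0 := ss_N S.
have c0' : 0 < c0 / 2 by lra.
have [K [R0 [K0 R01 bound]]] := curvature_bound S q_le0 c0'.
pose kap := K + 1; have kap0 : 0 < kap by rewrite /kap; lra.
have Kk : K <= kap ^+ 2 by rewrite /kap sqrrD; have := sqr_ge0 K; lra.
have kapn := ltW kap0; clearbody kap.
have an : alpha != 0 by rewrite lt_eqF.
have cn : c0 != 0 by rewrite gt_eqF.
have L0 : 0 < 4 * N * kap / - alpha by rewrite divr_gt0 ?oppr_gt0 // !mulr_gt0.
set L := 4 * N * kap / - alpha in L0.
have a2 : 0 < alpha ^+ 2 by rewrite exprn_even_gt0.
have q1 : 0 < 4 * K / alpha ^+ 2 by rewrite divr_gt0 // mulr_gt0.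
have q2 : 0 < 4 * L / c0 by rewrite divr_gt0 // mulr_gt0.
pose R1 := R0 + 4 * K / alpha ^+ 2.
have R1K t : R1 <= r t -> 4 * K <= alpha ^+ 2 * r t.
  by move=> h; rewrite [leRHS]mulrC -ler_pdivrMr //; apply: le_trans h; rewrite /R1; lra.
have R1R0 t : R1 <= r t -> R0 <= r t by apply: le_trans; rewrite /R1; lra.
have R1c : 1 <= R1 by rewrite /R1; lra.
have good t : c0 / 2 * r t <= w t -> R1 <= r t ->
    [/\ c0 / 2 * r t <= w t, 1 <= r t, m t < 0, k t * r t <= K &
      [/\ - alpha / 2 * r t <= - m t * p t, 0 < p t &
          (alpha * r t - m t * p t) ^+ 2 <= K]] /\
      0 <= x t * r t - p t * (w t - L).
  move=> wt rt; have [mt kr] := bound t wt (R1R0 t rt).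
  have r1 : 1 <= r t by lra.
  by have [h1 h2 h3 h4] := radial_growth K0 Kk kapn mt kr r1 (R1K t rt).
have [s0 [rs0 ws0]] := often (R1 + 1 + 4 * L / c0).
exists (c0 / 2), K, s0; split => //.
clearbody R1.
(* Under the induction hypothesis r has not decreased since s0, and w / r, which
   was at least c0 there, is still at least 3 c0 / 4: both constraints are strict. *)
pose g t := Num.min (w t - c0 / 2 * r t) (r t - R1).
suff pos : forall t, s0 <= t -> 0 < g t.
  move=> t /pos; rewrite /g lt_min !subr_gt0 => /andP[/ltW h1 /ltW h2].
  by have [] := good t h1 h2.
apply: continuous_induction => [u _|u s0u IH].
  apply: continuous_min.
    apply: is_derive_continuous.
    exact: is_deriveB_fun (ss_dw S u) (is_deriveZ_fun _ (ss_dr S u)).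
  exact: is_derive_continuous (is_deriveB_fun (ss_dr S u) (is_derive_cst_fun R1 u)).
have IH' v : s0 <= v < u -> 0 < p v /\ 0 <= x v * r v - p v * (w v - L).
  move=> /IH; rewrite /g le_min subr_ge0 subr_ge0 => /andP[h1 h2].
  by have [[_ _ _ _ [_ p0 _]] x0] := good v h1 h2.
have rmono v : s0 <= v <= u -> r s0 <= r v.
  move=> /andP[s0v vu]; apply: (derive_ge0_le s0v (fun t _ => ss_dr S t)).
  move=> t /andP[s0t tv]; have [p0 _] : 0 < p t /\ 0 <= x t * r t - p t * (w t - L).
    by apply: IH'; rewrite s0t (lt_le_trans tv).
  by rewrite mulr_ge0 // ltW.
have rpos v : s0 <= v <= u -> 0 < r v by move=> /rmono; lra.
have ru : r s0 <= r u by apply: rmono; rewrite s0u lexx.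
rewrite /g lt_min subr_gt0 subr_gt0; apply/andP; split; last by lra.
have ratio : (w s0 - L) * (r s0)^-1 <= (w u - L) * (r u)^-1.
  apply: (derive_ge0_le (f := fun t => (w t - L) * (r t)^-1)
    (f' := fun t => (2 * x t - 0) * (r t)^-1 +
       (w t - L) * (- (2 * p t) / r t ^+ 2)) s0u).
    move=> t /rpos r0; apply: is_deriveM_fun.
      exact: is_deriveB_fun (ss_dw S t) (is_derive_cst_fun L t).
    by apply: is_deriveV_fun (ss_dr S t); rewrite gt_eqF.
  move=> t /[dup] /IH'[_ h] /andP[s0t tu].
  have r0 : 0 < r t by apply: rpos; rewrite s0t ltW.
  have -> : (2 * x t - 0) * (r t)^-1 + (w t - L) * (- (2 * p t) / r t ^+ 2) =
    2 * (x t * r t - p t * (w t - L)) / r t ^+ 2 by field; rewrite gt_eqF.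
  by rewrite divr_ge0 ?sqr_ge0 // mulr_ge0.
have rs : 0 < r s0 by lra.
have ruz : 0 < r u by lra.
have hs : 3 / 4 * c0 <= (w s0 - L) * (r s0)^-1.
  rewrite ler_pdivlMr //.
  have : 4 * L <= r s0 * c0 by rewrite -ler_pdivrMr //; lra.
  by lra.
have : 3 / 4 * c0 * r u <= w u - L.
  by rewrite -ler_pdivlMr //; apply: le_trans ratio.
have : 0 < c0 * r u by rewrite mulr_gt0.
by lra.
Qed.

End Persistence.

(** * The monotone quantity V *)

Section Lyapunov.
Context {R : realType} {alpha N : R} {r w p q m k x e : R -> R}.
Context (S : scalar_soliton alpha N r w p q m k x e).
Implicit Types s t : R.

(** V along the curve. *)
Definition lyap s := expR (alpha / 2 * r s) * q s.

Lemma is_derive_lyap s :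
  is_derive s 1 lyap (expR (alpha / 2 * r s) * (w s - q s ^+ 2)).
Proof.
have he := is_derive_expR_fun (is_deriveZ_fun (alpha / 2) (ss_dr S s)).
apply: is_derive_eq (is_deriveM_fun he (ss_dq S s)) _.
by rewrite (ss_mE S); field.
Qed.

Lemma lyap_ndecr s t : s <= t -> lyap s <= lyap t.
Proof.
move=> st; apply: (derive_ge0_le st (fun u _ => is_derive_lyap u)) => u _.
by rewrite mulr_ge0 ?expR_ge0 // subr_ge0 (ss_q S).
Qed.

Context (lyap0 : lyap s @[s --> +oo_R] --> (0 : R)).

Lemma dotTAC_le0 s : q s <= 0.
Proof.
rewrite -(pmulr_rle0 _ (expR_gt0 (alpha / 2 * r s))) leNgt; apply/negP => V0.
have [M [_ hM]] := cvgr_lt 0 lyap0 _ V0.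
have [h1 h2] : M < Num.max s (M + 1) /\ s <= Num.max s (M + 1).
  by rewrite lt_max le_max lexx; split=> //; apply/orP; right; lra.
by have := hM _ h1; rewrite ltNge (lyap_ndecr h2).
Qed.

(** Along a bounded piece of the curve on which A C stays away from 0, V gains a
    definite amount, which can happen only finitely often. *)
Lemma radius_unbounded (c : R) : 0 < c ->
  (forall s0, exists2 s, s0 <= s & c * (1 + r s) <= w s) ->
  forall R1, exists s, R1 <= r s /\ c * r s <= w s.
Proof.
move=> c0 often R1; have N0 := ss_N S; have a0 := ss_alpha S.
apply: contrapT => /forallNP hR.
have rR s : c * (1 + r s) <= w s -> r s <= R1.
  move=> hw; have [//|/ltW h] := leP (r s) R1.
  by case: (hR s); split=> //; lra.
(* On [s, s + d] the quantity w only loses a factor 2. *)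
pose d := c / (4 * (N + c)).
have Nc : 0 < 4 * (N + c) by lra.
have d0 : 0 < d by rewrite divr_gt0.
have hd : d * (4 * (N + c)) = c by rewrite divfK // gt_eqF.
have d1 : d <= 1 by rewrite ler_pdivrMr //; lra.
have dc : d * c <= c / 4 by have := mulr_ge0 (ltW d0) (ltW N0); lra.
have dw y : c <= y -> d * y + d * N <= y / 2.
  move=> cy; have h : d <= 4^-1 by rewrite -(ler_pM2r Nc) hd; lra.
  have h1 : d * y <= 4^-1 * y by rewrite ler_wpM2r //; lra.
  by have := mulr_ge0 (ltW d0) (ltW c0); lra.
clearbody d.
(* eps bounds the weight exp(alpha r / 2) from below on [s, s + d].  If |V| stays
   below eps kap, then <T, A C>^2 <= kap^2 <= c / 4, so V grows at rate at least
   eps c / 4, and its gain over a length d exceeds 2 eps kap. *)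
pose eps := expR (2 * alpha * (R1 + 1)).
have eps0 : 0 < eps by exact: expR_gt0.
pose kap := c * d / (16 * (1 + c)).
have c16 : 0 < 16 * (1 + c) by lra.
have kap0 : 0 < kap by rewrite divr_gt0 // mulr_gt0.
have hk : kap * (16 * (1 + c)) = c * d by rewrite divfK // gt_eqF.
have kc : 0 < kap * c by rewrite mulr_gt0.
have cd : c * d <= c by rewrite ler_piMr // ltW.
have kap2 : kap ^+ 2 <= c / 4.
  have k1 : kap <= 1 by rewrite ler_pdivrMr //; lra.
  have : kap * kap <= kap * 1 by rewrite ler_pM2l.
  by rewrite expr2; lra.
clearbody kap.
have ek : 0 < eps * kap by rewrite mulr_gt0.
have /cvgrPdist_lt/(_ _ ek)[M [_ hM]] := lyap0.
have [s Ms ws] := often (M + 1).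
have ws' : c <= w s by apply: le_trans ws; have := ss_r S s; nra.
have rs := rR s ws.
have hV t : s <= t -> `|lyap t| < eps * kap.
  by move=> st; have := hM t; rewrite /= sub0r normrN; apply; lra.
have gain : lyap s + eps * (c / 4) * (s + d - s) <= lyap (s + d).
  have sd : s <= s + d by lra.
  have : lyap s - eps * (c / 4) * s <= lyap (s + d) - eps * (c / 4) * (s + d).
    apply: (derive_ge0_le (f := fun t => lyap t - eps * (c / 4) * t)
       (f' := fun t => expR (alpha / 2 * r t) * (w t - q t ^+ 2) -
          eps * (c / 4) * 1) sd).
      by move=> t _; apply: (is_deriveB_fun (is_derive_lyap t)).
    move=> t /andP[st td]; have std : s <= t <= s + 1 by rewrite st; lra.
    have rt : eps <= expR (alpha / 2 * r t).
      by rewrite ler_expR; have := sqC_unit_le S std; nra.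
    have wt : c / 2 <= w t.
      have h1 : 1 - d <= expR (-1 * (t - s)).
        by apply: le_trans (expR_ge1Dx _); lra.
      have := sqAC_exp_ge S st.
      have : (1 - d) * (w s + N) <= expR (-1 * (t - s)) * (w s + N).
        by rewrite ler_wpM2r //; lra.
      by have := dw _ ws'; lra.
    have qt : q t ^+ 2 <= kap ^+ 2.
      have := hV t st; rewrite /lyap normrM gtr0_norm ?expR_gt0 // => hq.
      rewrite -real_normK ?num_real // ler_sqr ?nnegrE ?(ltW kap0) //.
      rewrite -(ler_pM2l eps0); apply: le_trans (ltW hq).
      by rewrite ler_wpM2r.
    rewrite mulr1 subr_ge0; apply: ler_pM => //; lra.
  by lra.
have /ltr_normlP[_ h1] := hV (s + d) ltac:(lra).
have /ltr_normlP[h2 _] := hV s (lexx s).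
have : eps * (16 * kap) <= eps * (c * d) by rewrite ler_pM2l //; lra.
by lra.
Qed.

End Lyapunov.

Arguments lyap {R} alpha r q s.

(** * The exponential of a square matrix *)

Section MatrixExponential.
Context {R : realType} {n : nat}.
Implicit Types (M : 'M[R]_n) (s t : R).

Lemma exprZmx M t k : (t *: M) ^+ k = t ^+ k *: M ^+ k.
Proof.
elim: k => [|k IH]; first by rewrite !expr0 scale1r.
by rewrite !exprS IH -[LHS]scalemxAl -[X in _ *: X]scalemxAr scalerA.
Qed.

Lemma mx_expr_bound M : exists2 b : R, 0 <= b &
  forall k i j, `|(M ^+ k) i j| <= b ^+ k.
Proof.
exists (\sum_i \sum_j `|M i j|).
  by apply: sumr_ge0 => i _; apply: sumr_ge0 => j _.
set b := \sum_i _; have rowb i : \sum_j `|M i j| <= b.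
  rewrite /b [leRHS](bigD1 i) //= lerDl; apply: sumr_ge0 => i' _.
  exact: sumr_ge0.
elim=> [|k IH] i j.
  rewrite !expr0 [1 : 'M[R]_n]/GRing.one /= mxE.
  by case: (i == j); rewrite ?normr1 ?normr0.
rewrite !exprS [_ * _ : 'M[R]_n]/GRing.mul /= mxE.
apply: le_trans (ler_norm_sum _ _ _) _.
apply: (@le_trans _ _ (\sum_l `|M i l| * b ^+ k)).
  by apply: ler_sum => l _; rewrite normrM ler_wpM2l.
rewrite -mulr_suml ler_wpM2r //; apply: exprn_ge0.
by apply: le_trans (rowb i); exact: sumr_ge0.
Qed.

(** The coefficients of the power series of the entries of the l-th derivative
    of exp(t M). *)
Definition expmx_coef M l i j : R^nat := fun k => k`!%:R^-1 * (M ^+ (k + l)) i j.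

Lemma is_cvg_coef (c : R^nat) (a b t : R) : 0 <= b ->
  (forall k, `|c k| <= a * (k`!%:R^-1 * b ^+ k)) -> cvgn (pseries c t).
Proof.
move=> b0 hc; apply: normed_cvg.
have cv : cvgn (series (a *: exp_coeff (b * `|t|))).
  by apply: is_cvg_seriesZ; exact: is_cvg_series_exp_coeff.
have le k : `|c k * t ^+ k| <= (a *: exp_coeff (b * `|t|)) k.
  rewrite normrM normrX; apply: le_trans (ler_wpM2r (exprn_ge0 _ _) (hc k)) _ => //.
  suff -> : (a *: exp_coeff (b * `|t|)) k = a * (k`!%:R^-1 * b ^+ k) * `|t| ^+ k by [].
  by rewrite -[LHS]/(a * exp_coeff (b * `|t|) k) /exp_coeff /= exprMn; ring.
by apply: (series_le_cvg _ _ le cv) => k; [|apply: le_trans (le k)].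
Qed.

Lemma is_cvg_expmx_coef M l i j t : cvgn (pseries (expmx_coef M l i j) t).
Proof.
have [b b0 hb] := mx_expr_bound M.
apply: (@is_cvg_coef _ (b ^+ l) b) => // k.
rewrite /expmx_coef normrM ger0_norm ?invr_ge0 // mulrCA.
by rewrite ler_wpM2l ?invr_ge0 // -exprD addnC hb.
Qed.

Lemma expmx_coef_diffs M l i j :
  pseries_diffs (expmx_coef M l i j) = expmx_coef M l.+1 i j.
Proof.
apply/funext => k; rewrite /pseries_diffs /expmx_coef factS natrM invfM.
by rewrite -!mulrA mulVKf ?pnatr_eq0 // addSnnS.
Qed.

Lemma cvg_sum_fun (I T : Type) (F : set_system T) {FF : Filter F} (l : seq I)
    (f : I -> T -> R) (a : I -> R) :
  (forall i, f i x @[x --> F] --> a i) ->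
  \sum_(i <- l) f i x @[x --> F] --> \sum_(i <- l) a i.
Proof.
move=> hf; elim: l => [|i l IH].
  by rewrite big_nil; under eq_fun do rewrite big_nil; exact: cvg_cst.
by rewrite big_cons; under eq_fun do rewrite big_cons; exact: cvgD.
Qed.

(** Entrywise convergence of matrices implies convergence. *)
Lemma cvg_mx (U : nat -> 'M[R]_n) (L : 'M[R]_n) :
  (forall i j, U k i j @[k --> \oo] --> L i j) -> U k @[k --> \oo] --> L.
Proof.
move=> hU; apply/cvgrPdist_le => /= e e0; near=> k.
rewrite /Num.Def.normr/= mx_normrE (bigmax_le _ (ltW e0))//= => i _.
rewrite !mxE/=; move: i; near: k; apply: filter_forall => /= i.
exact: ((cvgrPdist_le _ _).1 (hU i.1 i.2)).
Unshelve. all: by end_near. Qed.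

Lemma expmxE M t i j : expmx (t *: M) i j = limn (pseries (expmx_coef M 0 i j) t).
Proof.
pose L := \matrix_(i, j) limn (pseries (expmx_coef M 0 i j) t).
suff : series (fun k : nat => k`!%:R^-1 *: (t *: M) ^+ k) k @[k --> \oo] --> L.
  by move=> /cvg_lim h; rewrite /expmx h ?mxE //; exact: norm_hausdorff.
apply: cvg_mx => i' j'; rewrite mxE.
suff -> : (fun k => series (fun k : nat => k`!%:R^-1 *: (t *: M) ^+ k) k i' j') =
  pseries (expmx_coef M 0 i' j') t by exact: is_cvg_expmx_coef.
apply/funext => k; rewrite /pseries /series /= summxE.
apply: eq_bigr => l _; rewrite exprZmx !mxE /expmx_coef addn0.
by rewrite mulrAC mulrA.
Qed.

Lemma is_derive_expmx M t i j :
  is_derive t 1 (fun t => expmx (t *: M) i j) ((expmx (t *: M) *m M) i j).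
Proof.
have -> : (fun t => expmx (t *: M) i j) =
    (fun t => limn (pseries (expmx_coef M 0 i j) t)).
  by apply/funext => u; exact: expmxE.
have h : `|t| < `|(`|t| + 1)| by rewrite [ltRHS]ger0_norm ?addr_ge0 // ltrDl.
apply: is_derive_eq.
  apply: (pseries_snd_diffs _ _ _ h); rewrite ?expmx_coef_diffs; exact: is_cvg_expmx_coef.
rewrite expmx_coef_diffs mxE.
apply: cvg_lim; first exact: Rhausdorff.
have -> : pseries (expmx_coef M 1 i j) t =
    (fun k => \sum_l pseries (expmx_coef M 0 i l) t k * M l j).
  apply/funext => k; rewrite /pseries /series /=.
  under [RHS]eq_bigr do rewrite mulr_suml.
  rewrite exchange_big; apply: eq_bigr => k' _; rewrite /expmx_coef addn1 exprSr.
  rewrite [_ * M : 'M[R]_n]/GRing.mul /= mxE mulr_sumr mulr_suml.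
  by apply: eq_bigr => l _; rewrite addn0; ring.
apply: cvg_sum_fun => l; rewrite expmxE; apply: cvgMl.
exact: is_cvg_expmx_coef.
Qed.

Lemma expmx0 : expmx (0 : 'M[R]_n) = 1%:M.
Proof.
apply: cvg_lim; first exact: norm_hausdorff.
rewrite -cvg_shiftS.
suff -> : (fun k => series (fun k : nat => k`!%:R^-1 *: (0 : 'M[R]_n) ^+ k) k.+1) =
   (fun=> 1%:M) by exact: cvg_cst.
apply/funext => k; rewrite /series /= big_nat_recl //= expr0 invr1 scale1r.
by rewrite big1 ?addr0 // => i _; rewrite exprS mul0r scaler0.
Qed.

(** The powers of M commute with M, hence so does exp(t M). *)
Lemma expmx_comm M t : expmx (t *: M) *m M = M *m expmx (t *: M).
Proof.
apply/matrixP => i j; rewrite !mxE.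
have h l1 l2 :
    (fun k => pseries (expmx_coef M 0 l1 l2) t k) @ \oo --> expmx (t *: M) l1 l2.
  by rewrite expmxE; exact: is_cvg_expmx_coef.
have h1 : \sum_l pseries (expmx_coef M 0 i l) t k * M l j @[k --> \oo] -->
    \sum_l expmx (t *: M) i l * M l j.
  by apply: cvg_sum_fun => l; apply: cvgMl; exact: h.
have h2 : \sum_l M i l * pseries (expmx_coef M 0 l j) t k @[k --> \oo] -->
    \sum_l M i l * expmx (t *: M) l j.
  by apply: cvg_sum_fun => l; apply: cvgMr; exact: h.
suff e : (fun k => \sum_l pseries (expmx_coef M 0 i l) t k * M l j) =
         (fun k => \sum_l M i l * pseries (expmx_coef M 0 l j) t k).
  by rewrite e in h1; exact: (cvg_unique _ h1 h2).
apply/funext => k; rewrite /pseries /series /=.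
under eq_bigr do rewrite mulr_suml.
under [RHS]eq_bigr do rewrite mulr_sumr.
rewrite exchange_big [RHS]exchange_big; apply: eq_bigr => k' _ /=.
have : (M ^+ k' * M) i j = (M * M ^+ k') i j by rewrite -exprSr exprS.
rewrite [M ^+ k' * M : 'M[R]_n]/GRing.mul [M * M ^+ k' : 'M[R]_n]/GRing.mul /= !mxE.
move=> e; transitivity (k'`!%:R^-1 * t ^+ k' * \sum_l (M ^+ k') i l * M l j).
  by rewrite mulr_sumr; apply: eq_bigr => l _; rewrite /expmx_coef addn0; ring.
rewrite e mulr_sumr; apply: eq_bigr => l _; rewrite /expmx_coef addn0; ring.
Qed.

End MatrixExponential.

(** * The logarithmic parameter *)

Section LogParameter.
Context {R : realType} {alpha N : R} {r w p q m k x e : R -> R}.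
Context (S : scalar_soliton alpha N r w p q m k x e).
(** From s0 on the curve stays in the region described by [persistence]. *)
Context {K s0 : R} (K0 : 0 < K).
Context (good : forall t, s0 <= t -> [/\ 1 <= r t, m t < 0, k t * r t <= K &
  [/\ - alpha / 2 * r t <= - m t * p t, 0 < p t &
      (alpha * r t - m t * p t) ^+ 2 <= K]]).
Implicit Types s t : R.

(** The length of a = (alpha + A) C. *)
Definition lena t := Num.sqrt (alpha ^+ 2 * r t + w t).

Let a0 : alpha < 0. Proof. exact: ss_alpha S. Qed.
Let N0 : 0 < N. Proof. exact: ss_N S. Qed.
Let a2 : 0 < alpha ^+ 2. Proof. by rewrite exprn_even_gt0 //= lt_eqF // (ss_alpha S). Qed.

Lemma lena_sqr t : lena t ^+ 2 = alpha ^+ 2 * r t + w t.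
Proof. by rewrite sqr_sqrtr // addr_ge0 ?(ss_w S) // mulr_ge0 ?sqr_ge0 ?(ss_r S). Qed.

Lemma lena_gt0 t : s0 <= t -> 0 < lena t.
Proof.
move=> /good[r1 _ _ _]; rewrite sqrtr_gt0 ltr_pwDl ?(ss_w S) // mulr_gt0 ?a2 //.
by lra.
Qed.

(** The speed of the radius is bounded below. *)
Lemma radius_to_infty M : \forall t \near +oo_R, M <= r t.
Proof.
have Q0 : 0 < alpha ^+ 2 + N by rewrite addr_gt0 ?a2 // N0.
pose d := - alpha / (2 * (alpha ^+ 2 + N + 1)).
have D0 : 0 < 2 * (alpha ^+ 2 + N + 1) by lra.
have d0 : 0 < d by rewrite divr_gt0 ?oppr_gt0 ?a0.
have hd : d * (2 * (alpha ^+ 2 + N + 1)) = - alpha by rewrite divfK // gt_eqF.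
clearbody d.
have pd t : s0 <= t -> d <= p t.
  move=> /good[r1 m0 _ [mp p0 _]]; rewrite leNgt; apply/negP => pd.
  have m2 := tana_sqr_le S t.
  have h1 : (- alpha / 2 * r t) ^+ 2 <= (- m t * p t) ^+ 2.
    by rewrite ler_sqr ?nnegrE ?mulr_ge0 //; have := a0; lra.
  have h2 : (- m t * p t) ^+ 2 <= (alpha ^+ 2 + N) * r t * d ^+ 2.
    rewrite exprMn sqrrN ler_pM ?sqr_ge0 // ler_sqr ?nnegrE; lra.
  have h3 := le_trans h1 h2.
  have h4 : (alpha ^+ 2 + N) * r t * d ^+ 2 < (- alpha / 2 * r t) ^+ 2.
    have -> : - alpha / 2 * r t = (alpha ^+ 2 + N + 1) * r t * d by rewrite -hd; field.
    rewrite exprMn ltr_pM2r ?exprn_gt0 // exprMn.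
    have rr : r t <= r t ^+ 2 by rewrite expr2 ler_peMl // (ss_r S).
    have r2 : 0 < r t ^+ 2 by lra.
    have q1 := ler_wpM2l (ltW Q0) rr.
    apply: (le_lt_trans q1); rewrite ltr_pM2r // sqrrD.
    by have := sqr_ge0 (alpha ^+ 2 + N); lra.
  by lra.
have grow t : s0 <= t -> r s0 + 2 * d * (t - s0) <= r t.
  move=> st; have : r s0 - 2 * d * s0 <= r t - 2 * d * t.
    apply: (derive_ge0_le (f := fun t => r t - 2 * d * t)
      (f' := fun t => 2 * p t - 2 * d * 1) st) => [u _|u /andP[su _]].
      exact: is_deriveB_fun (ss_dr S u) (is_deriveZ_fun _ (is_derive_id u 1)).
    by have := pd u su; lra.
  by lra.
exists (s0 + `|M| / (2 * d)); split; first exact: num_real.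
move=> t /= ht; have d2 : 0 < 2 * d by lra.
have Md : 0 <= `|M| / (2 * d) by rewrite divr_ge0 // ltW.
have st : s0 <= t by lra.
have : `|M| <= 2 * d * (t - s0).
  by rewrite mulrC -ler_pdivrMr //; lra.
by have := grow t st; have := ss_r S s0; have := ler_norm M; lra.
Qed.

Context {sigma : R -> R} {s1 : R} (s01 : s0 <= s1).
Context (dsigma : forall t, s1 <= t -> is_derive t 1 sigma (lena t)^-1).

(** The squared radius, rescaled by the expected growth, and its derivative. *)
Definition scaled t := expR (2 * alpha * sigma t) * r t.
Definition dscaled t := expR (2 * alpha * sigma t) * (2 * (alpha * r t / lena t + p t)).

Lemma is_derive_scaled t : s1 <= t -> is_derive t 1 scaled (dscaled t).
Proof.
move=> st; have h := is_derive_expR_fun (is_deriveZ_fun (2 * alpha) (dsigma st)).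
by apply: is_derive_eq (is_deriveM_fun h (ss_dr S t)) _; rewrite /dscaled; ring.
Qed.

(** As dC / dsigma is close to - a, the radius grows like exp(- alpha sigma),
    and the relative error is integrable against the radius. *)
Lemma scaled_rate : exists2 B : R, 0 < B & forall t, s0 <= t ->
  `|alpha * r t / lena t + p t| <= B * p t / r t.
Proof.
have al := a0; have K1 := K0; pose kap := K + 1.
have kap0 : 0 < kap by rewrite /kap; lra.
have Kk : K <= kap ^+ 2 by rewrite /kap sqrrD; have := sqr_ge0 K; lra.
clearbody kap.
pose B := K / alpha ^+ 2 + 2 * kap / - alpha.
have B0 : 0 < B by rewrite addr_gt0 // divr_gt0 ?oppr_gt0 ?a0 ?a2 ?mulr_gt0.
exists B => // t st; have [r1 m0 kr [mp p0 y2]] := good st.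
have l0 := lena_gt0 st; have l2 := lena_sqr t.
have r0 : 0 < r t by lra.
have [y3 y4] := sqr_le_itv (ltW kap0) (le_trans y2 Kk).
set y := alpha * r t - m t * p t in y3 y4.
have yk : `|y| <= kap by rewrite ler_norml y3.
set l := lena t in l0 l2 *.
have kE : (m t + l) * (l - m t) = k t.
  by rewrite (ss_kE S) -l2; ring.
have ml0 : 0 <= m t + l.
  by rewrite -(pmulr_lge0 _ (_ : 0 < l - m t)) ?kE ?(ss_k S) //; lra.
have ml : (m t + l) * l <= k t.
  by rewrite -kE ler_wpM2l //; lra.
have -> : alpha * r t / l + p t = ((m t + l) * p t + y) / l.
  by rewrite /y; field; rewrite gt_eqF.
rewrite normrM normfV (gtr0_norm l0) ler_pdivrMr // mulrAC ler_pdivlMr //.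
have h1 : (m t + l) * p t * r t <= K / alpha ^+ 2 * (l * p t).
  have e1 : (m t + l) * l * r t <= K.
    by apply: le_trans kr; rewrite ler_wpM2r // (ss_r S).
  have e2 : alpha ^+ 2 <= l ^+ 2.
    rewrite l2; apply: (@le_trans _ _ (alpha ^+ 2 * r t)).
      by rewrite ler_peMr // ltW ?a2.
    by rewrite lerDl (ss_w S).
  have e3 : (m t + l) * r t <= K / alpha ^+ 2 * l.
    rewrite -(ler_pM2r l0); apply: (@le_trans _ _ K); first by rewrite mulrAC.
    have Ka : 0 <= K / alpha ^+ 2 by rewrite divr_ge0 // ltW ?a2.
    have := ler_wpM2l Ka e2; rewrite divfK ?lt0r_neq0 ?a2 // => e3.
    by rewrite -[leRHS]mulrA -[l * l]expr2.
  rewrite mulrAC mulrA ler_wpM2r // ltW //.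
have h2 : kap * r t <= 2 * kap / - alpha * (l * p t).
  have e1 : - alpha / 2 * r t <= l * p t.
    by apply: le_trans mp _; rewrite ler_wpM2r ?(ltW p0) //; lra.
  have e2 : 0 <= 2 * kap / - alpha by rewrite divr_ge0 ?oppr_ge0 ?(ltW a0) //; lra.
  apply: le_trans (ler_wpM2l e2 e1).
  suff -> : 2 * kap / - alpha * (- alpha / 2 * r t) = kap * r t by [].
  by field; rewrite lt_eqF ?a0.
apply: (@le_trans _ _ (((m t + l) * p t + kap) * r t)).
  rewrite ler_wpM2r ?(ss_r S) // (le_trans (ler_normD _ _)) // lerD //.
  by rewrite ger0_norm // mulr_ge0 // ltW.
by rewrite mulrDl /B; lra.
Qed.

Lemma scaled_bounds : exists Z1 Z2 : R, [/\ 0 < Z1, 0 < Z2 & forall t, s1 <= t ->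
  Z1 <= scaled t <= Z2].
Proof.
have [B B0 rate] := scaled_rate.
have rs t : s1 <= t -> 1 <= r t by move=> st; have [] := good (le_trans s01 st).
have dinv c t : s1 <= t -> is_derive t 1 (fun t => expR (c * (r t)^-1))
    (c * (- (2 * p t) / r t ^+ 2) * expR (c * (r t)^-1)).
  move=> st; apply: is_derive_expR_fun; apply: is_deriveZ_fun.
  by apply: is_deriveV_fun (ss_dr S t); rewrite gt_eqF //; have := rs t st; lra.
have bnd t : s1 <= t -> `|dscaled t| <= scaled t * (B * (2 * p t) / r t ^+ 2).
  move=> st; have r0 : 0 < r t by have := rs t st; lra.
  rewrite /dscaled /scaled normrM gtr0_norm ?expR_gt0 //.
  rewrite -[leRHS]mulrA ler_pM2l ?expR_gt0 //.
  rewrite normrM ger0_norm //.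
  have -> : r t * (B * (2 * p t) / r t ^+ 2) = 2 * (B * p t / r t).
    by field; rewrite gt_eqF.
  by rewrite ler_pM2l // rate // (le_trans s01).
(* The factors exp(- B / r) and exp(B / r) absorb the error made in treating the
   rescaled radius as constant. *)
have lo t : s1 <= t ->
    scaled s1 * expR (- B * (r s1)^-1) <= scaled t * expR (- B * (r t)^-1).
  move=> st; apply: (derive_ge0_le (f := fun t => scaled t * expR (- B * (r t)^-1))
    (f' := fun u => dscaled u * expR (- B * (r u)^-1) +
      scaled u * (- B * (- (2 * p u) / r u ^+ 2) * expR (- B * (r u)^-1))) st).
    move=> u /andP[su _]; exact: is_deriveM_fun (is_derive_scaled su) (dinv (- B) u su).
  move=> u /andP[su _]; have /ler_normlP[h _] := bnd u su.
  have -> : dscaled u * expR (- B * (r u)^-1) +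
      scaled u * (- B * (- (2 * p u) / r u ^+ 2) * expR (- B * (r u)^-1)) =
    expR (- B * (r u)^-1) * (dscaled u + scaled u * (B * (2 * p u) / r u ^+ 2)) by ring.
  by rewrite mulr_ge0 ?expR_ge0 //; lra.
have hi t : s1 <= t ->
    scaled t * expR (B * (r t)^-1) <= scaled s1 * expR (B * (r s1)^-1).
  move=> st; rewrite -lerN2; apply: (derive_ge0_le
    (f := fun t => - (scaled t * expR (B * (r t)^-1)))
    (f' := fun u => - (dscaled u * expR (B * (r u)^-1) +
      scaled u * (B * (- (2 * p u) / r u ^+ 2) * expR (B * (r u)^-1)))) st).
    move=> u /andP[su _]; apply: is_deriveN.
    exact: is_deriveM_fun (is_derive_scaled su) (dinv B u su).
  move=> u /andP[su _]; have /ler_normlP[_ h] := bnd u su.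
  have -> : - (dscaled u * expR (B * (r u)^-1) +
      scaled u * (B * (- (2 * p u) / r u ^+ 2) * expR (B * (r u)^-1))) =
    expR (B * (r u)^-1) * (scaled u * (B * (2 * p u) / r u ^+ 2) - dscaled u) by ring.
  by rewrite mulr_ge0 ?expR_ge0 //; lra.
have sc0 t : s1 <= t -> 0 < scaled t.
  by move=> st; rewrite mulr_gt0 ?expR_gt0 //; have := rs t st; lra.
exists (scaled s1 * expR (- B * (r s1)^-1)), (scaled s1 * expR (B * (r s1)^-1)).
have sc1 := sc0 _ (lexx s1).
split; [exact: mulr_gt0 sc1 (expR_gt0 _)|exact: mulr_gt0 sc1 (expR_gt0 _)|move=> t st].
have rt0 : 0 <= (r t)^-1 by rewrite invr_ge0 (ss_r S).
apply/andP; split.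
  apply: (le_trans (lo t st)); rewrite ler_piMr ?(ltW (sc0 t st)) //.
  by rewrite -expR0 ler_expR mulNr oppr_le0 mulr_ge0 // ltW.
apply: le_trans (hi t st); rewrite ler_peMr ?(ltW (sc0 t st)) //.
by rewrite -expR0 ler_expR mulr_ge0 // ltW.
Qed.

Lemma sigma_to_infty : sigma t @[t --> +oo_R] --> +oo_R.
Proof.
have [Z1 [Z2 [_ Z20 hZ]]] := scaled_bounds.
apply/cvgryPge => M.
have h := radius_to_infty (Z2 / expR (2 * alpha * M) + 1).
have hs : \forall t \near +oo_R, s1 <= t by apply: nbhs_pinfty_ge; exact: num_real.
near=> t.
have st : s1 <= t by near: t.
have rt : Z2 / expR (2 * alpha * M) + 1 <= r t by near: t.
rewrite leNgt; apply/negP => sM.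
have e1 : expR (2 * alpha * M) <= expR (2 * alpha * sigma t).
  by rewrite ler_expR ler_wnM2l ?(ltW sM) //; have := a0; lra.
have /andP[_ h2] := hZ t st.
have r1 : Z2 / expR (2 * alpha * M) < r t by lra.
have : Z2 < expR (2 * alpha * M) * r t by rewrite mulrC -ltr_pdivrMr ?expR_gt0.
have : expR (2 * alpha * M) * r t <= scaled t by rewrite ler_wpM2r ?(ss_r S).
by lra.
Unshelve. all: by end_near. Qed.

(** The left-hand side is the squared speed, with respect to arc length, of
    exp(sigma (alpha + A)) C, since |a / |a| + T|^2 = 2 (|a| + m) / |a|. *)
Lemma unwound_speed : exists2 D : R, 0 < D & forall t, s1 <= t ->
  expR (2 * alpha * sigma t) * (2 * (lena t + m t) / lena t) <=
  (D * expR (2 * alpha * sigma t) / lena t) ^+ 2.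
Proof.
have [Z1 [Z2 [Z10 _ hZ]]] := scaled_bounds.
have K1 := K0; exists (2 * K / Z1 + 1).
  by rewrite addr_gt0 // divr_gt0 // mulr_gt0.
move=> t st; have [r1 m0 kr _] := good (le_trans s01 st).
have l0 := lena_gt0 (le_trans s01 st).
have /andP[h _] := hZ t st; rewrite /scaled in h.
set E := expR _ in h *; have E0 : 0 < E by exact: expR_gt0.
set l := lena t in l0 *.
have kE : (m t + l) * (l - m t) = k t.
  by rewrite (ss_kE S) -lena_sqr -/l; ring.
have ml0 : 0 <= m t + l.
  by rewrite -(pmulr_lge0 _ (_ : 0 < l - m t)) ?kE ?(ss_k S) //; lra.
have ml : (m t + l) * l <= k t.
  by rewrite -kE ler_wpM2l //; lra.
have kZ : k t <= K / Z1 * E.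
  rewrite mulrAC ler_pdivlMr //.
  have h1 : k t * Z1 <= k t * (E * r t) by rewrite ler_wpM2l ?(ss_k S).
  apply: (le_trans h1); rewrite mulrCA mulrC ler_wpM2r //; exact: ltW.
have -> : E * (2 * (l + m t) / l) = 2 * E * ((m t + l) * l) / l ^+ 2.
  by field; rewrite gt_eqF.
rewrite exprMn exprVn ler_wpM2r ?invr_ge0 ?sqr_ge0 //.
apply: (@le_trans _ _ (2 * E * (K / Z1 * E))).
  by rewrite ler_wpM2l ?mulr_ge0 ?(ltW E0) // (le_trans ml).
have -> : 2 * E * (K / Z1 * E) = (2 * K / Z1) * E ^+ 2 by field; rewrite gt_eqF.
rewrite exprMn ler_wpM2r ?sqr_ge0 // sqrrD.
have : 0 < 2 * K / Z1 by rewrite divr_gt0 // mulr_gt0.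
by move=> h0; have := sqr_ge0 (2 * K / Z1); lra.
Qed.

End LogParameter.

Arguments lena {R} alpha r w t.
Arguments scaled {R} alpha r sigma t.

(** * Convergence to a logarithmic spiral *)

Section NormalExponential.
Context {R : realType} {n : nat} (alpha : R) (A : 'M[R]_n).
Context (A_anti : A^T = - A).
Implicit Types (t : R) (v : 'cV[R]_n).
Local Notation B := (alpha%:M + A).
Local Notation Phi t := (expmx (t *: B)).

Lemma is_vderive_mulmx_fun (P : R -> 'M[R]_n) (dP : 'M[R]_n) (u : R -> 'cV[R]_n) t du :
  (forall i j, is_derive t 1 (fun t => P t i j) (dP i j)) -> is_vderive u t du ->
  is_vderive (fun t => P t *m u t) t (dP *m u t + P t *m du).
Proof.
move=> hP hu i.
have -> : (fun t => (P t *m u t) i 0) = (fun t => \sum_j P t i j * u t j 0).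
  by apply/funext => s; rewrite mxE.
rewrite !mxE -big_split /=; apply: is_derive_sum_fun => j; exact: is_deriveM_fun.
Qed.

Lemma is_vderive_Phi_cst v t : is_vderive (fun t => Phi t *m v) t (B *m (Phi t *m v)).
Proof.
have hv : is_vderive (fun=> v : 'cV[R]_n) t 0.
  by move=> i; rewrite mxE; exact: is_derive_cst_fun.
have := is_vderive_mulmx_fun (fun i j => is_derive_expmx B t i j) hv.
by rewrite mulmx0 addr0 expmx_comm -mulmxA.
Qed.

(** exp(t (alpha + A)) multiplies all lengths by exp(alpha t). *)
Lemma dotv_Phi v t : dotv (Phi t *m v) (Phi t *m v) = expR (2 * alpha * t) * dotv v v.
Proof.
pose f u := expR (- (2 * alpha) * u) * dotv (Phi u *m v) (Phi u *m v).
have f0 : f t = f 0.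
  apply: is_derive_0_is_cst => u.
  have h := is_vderive_Phi_cst v u.
  have h1 := is_derive_expR_fun (is_deriveZ_fun (- (2 * alpha)) (is_derive_id u (1 : R))).
  apply: is_derive_eq (is_deriveM_fun h1 (is_derive_dotv h h)) _.
  set P := Phi u *m v; rewrite mulr1 mulmxDl mul_scalar_mx.
  rewrite !dotvDl !dotvDr !dotvZl !dotvZr.
  by rewrite (dotvC (A *m P)) (dotv_anti _ A_anti); ring.
move: f0; rewrite /f mulr0 expR0 mul1r scale0r expmx0 mul1mx => <-.
by rewrite mulrA -expRD mulNr subrr expR0 mul1r.
Qed.

Lemma Phi_inv t : Phi (- t) *m Phi t = 1%:M.
Proof.
apply/matrixP => i j.
pose f u := (Phi (- u) *m Phi u) i j.
have -> : (Phi (- t) *m Phi t) i j = f 0.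
  have -> : (Phi (- t) *m Phi t) i j = f t by [].
  apply: is_derive_0_is_cst => u.
  have -> : f = fun u => \sum_l Phi (- u) i l * Phi u l j.
    by apply/funext => s; rewrite /f mxE.
  apply: is_derive_eq.
    apply: is_derive_sum_fun => l; apply: is_deriveM_fun.
      exact: (is_derive1_comp (is_derive_expmx B (- u) i l) (is_deriveNid u 1)).
    exact: is_derive_expmx.
  rewrite big_split /=.
  have e1 : \sum_l (Phi (- u) *m B) i l * -1 * Phi u l j =
      - (Phi (- u) *m B *m Phi u) i j.
    by rewrite [in RHS]mxE -sumrN; apply: eq_bigr => l _; ring.
  have e2 : \sum_l Phi (- u) i l * (Phi u *m B) l j = (Phi (- u) *m (Phi u *m B)) i j.
    by rewrite [in RHS]mxE.
  by rewrite e1 e2 expmx_comm mulmxA addNr.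
by rewrite /f oppr0 scale0r expmx0 mul1mx.
Qed.

End NormalExponential.

(** A curve whose speed is dominated by that of a nonnegative nonincreasing
    function G stays within distance sqrt n * G of some fixed Gamma: coordinate
    by coordinate, Y - G is nondecreasing, Y + G is nonincreasing, and Gamma
    separates them. *)
Lemma curve_limit (R : realType) (n : nat) (Y dY : R -> 'cV[R]_n)
    (G dG : R -> R) (s1 : R) :
  (forall t, s1 <= t -> is_vderive Y t (dY t)) ->
  (forall t, s1 <= t -> is_derive t 1 G (dG t)) ->
  (forall t, s1 <= t -> dotv (dY t) (dY t) <= dG t ^+ 2) ->
  (forall t, s1 <= t -> dG t <= 0) -> (forall t, s1 <= t -> 0 <= G t) ->
  exists Gamma : 'cV[R]_n, forall t, s1 <= t ->
    dotv (Y t - Gamma) (Y t - Gamma) <= n%:R * G t ^+ 2.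
Proof.
move=> hY hG sp dG0 G0.
have dYi t i : s1 <= t -> `|dY t i 0| <= - dG t.
  move=> st; have h : dY t i 0 ^+ 2 <= (- dG t) ^+ 2.
    by rewrite sqrrN; apply: le_trans (sp t st); exact: coord_le_dotv.
  have dn : 0 <= - dG t by rewrite oppr_ge0 dG0.
  by have [h1 h2] := sqr_le_itv dn h; rewrite ler_norml h1.
have up i s t : s1 <= s -> s <= t -> Y s i 0 - G s <= Y t i 0 - G t.
  move=> ss st; apply: (derive_ge0_le (f := fun t => Y t i 0 - G t)
    (f' := fun t => dY t i 0 - dG t) st).
    move=> u /andP[su _]; have s1u := le_trans ss su.
    exact: is_deriveB_fun (hY u s1u i) (hG u s1u).
  move=> u /andP[su _]; have := dYi u i (le_trans ss su).
  by rewrite ler_norml => /andP[]; lra.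
have dn i s t : s1 <= s -> s <= t -> Y t i 0 + G t <= Y s i 0 + G s.
  move=> ss st; rewrite -lerN2; apply: (derive_ge0_le (f := fun t => - (Y t i 0 + G t))
    (f' := fun t => - (dY t i 0 + dG t)) st).
    move=> u /andP[su _]; have s1u := le_trans ss su.
    exact: is_deriveN (is_deriveD_fun (hY u s1u i) (hG u s1u)).
  move=> u /andP[su _]; have := dYi u i (le_trans ss su).
  by rewrite ler_norml => /andP[]; lra.
pose E i := [set Y t i 0 - G t | t in [set t | s1 <= t]].
have ubE i s : s1 <= s -> ubound (E i) (Y s i 0 + G s).
  move=> ss _ [t /= st <-]; have [ts|/ltW ts] := leP t s.
    by have := up i t s st ts; have := G0 s ss; lra.
  by have := dn i s t ss ts; have := G0 t st; lra.
have E0 i : E i !=set0 by exists (Y s1 i 0 - G s1); exists s1 => /=.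
exists (\col_i sup (E i)) => t st.
have coord i : `|(Y t - \col_i sup (E i)) i 0| <= G t.
  rewrite !mxE ler_norml; apply/andP; split.
    by have := ge_sup (E0 i) (ubE i t st); lra.
  have : Y t i 0 - G t <= sup (E i).
    by apply: ub_le_sup; [exists (Y s1 i 0 + G s1); exact: ubE|exists t].
  by lra.
rewrite /dotv; apply: (@le_trans _ _ (\sum_(i < n) G t ^+ 2)).
  apply: ler_sum => i _; rewrite -expr2 -real_normK ?num_real //.
  by rewrite ler_sqr ?nnegrE ?coord // (G0 t st).
by rewrite sumr_const card_ord mulr_natl.
Qed.

(** * Solitons *)

Section Solitons.
Context {R : realType} {n : nat} {alpha : R} {A : 'M[R]_n} {C : R -> 'cV[R]_n}.
Context (A_anti : A^T = - A) (C_soliton : soliton alpha A C).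
Implicit Types s t : R.
Local Notation B := (alpha%:M + A).
Local Notation r := (sqC C).
Local Notation w := (sqAC A C).
Local Notation m := (tana alpha A C).
Local Notation k := (sqcurv alpha A C).
Local Notation soliton_system N := (scalar_soliton alpha N r w (dotCT C)
  (dotTAC A C) m k (dotACAT A C) (dotATcurv alpha A C)).

Lemma soliton_scalar : alpha < 0 -> exists N : R, soliton_system N.
Proof.
move=> a0; have [N N0 hN] := mulmx_bound A; exists N.
constructor => // s.
- exact: sqC_ge0.
- exact: sqAC_ge0.
- exact: sqcurv_ge0.
- exact: sqAC_le.
- exact: tanaE.
- by rewrite /sqcurv sqaE.
- exact: (dotCT_sqr C_soliton).
- exact: (dotTAC_sqr C_soliton).
- exact: (dotACAT_sqr C_soliton hN).
- exact: (dotATcurv_sqr C_soliton hN).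
- exact: (is_derive_sqC C_soliton).
- exact: (is_derive_sqAC C_soliton).
- exact: (is_derive_dotTAC A_anti C_soliton).
- exact: (is_derive_tana A_anti C_soliton).
- exact: (is_derive_sqcurv A_anti C_soliton).
- exact: (curvC_sqr A_anti C_soliton).
- exact: (curvAC_sqr A_anti C_soliton).
- exact: (curvA_sqr A_anti C_soliton hN).
Qed.

Lemma enorm_avec s : enorm (avec alpha A (C s)) = lena alpha r w s.
Proof. by rewrite /enorm -/(sqa alpha A C s) (sqaE alpha C A_anti). Qed.

(** At a limit point, a continuous function is approximated by its values
    arbitrarily far along the orbit. *)
Lemma omega_approx (f : 'cV[R]_n * 'cV[R]_n -> R) P T (e : R) s0 :
  {for (P, T), continuous f} -> omega_limit (orbit_pt C) (P, T) -> 0 < e ->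
  exists2 s, s0 <= s & `|f (P, T) - f (orbit_pt C s)| < e.
Proof.
move=> cf om e0.
have s1 : 0 < Num.max s0 1 by rewrite lt_max ltr01 orbT.
have near : nbhs (P, T) [set x | `|f (P, T) - f x| < e].
  exact: ((cvgrPdist_lt _ _).1 cf e e0).
have [x [[s /= hs <-] hx]] := om _ s1 _ near.
by exists s => //; apply: le_trans hs; rewrite le_max lexx.
Qed.

Lemma continuous_dotv_mulmx (M : 'M[R]_n) :
  continuous (fun u : 'cV[R]_n => dotv (M *m u) (M *m u)).
Proof.
have c1 i : continuous (fun u : 'cV[R]_n => (M *m u) i 0).
  move=> u; rewrite /continuous_at mxE; under eq_fun do rewrite mxE.
  apply: (@cvg_sum_fun _ _ _ (nbhs u) (nbhs_filter u)) => j.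
  by apply: cvgMr; exact: coord_continuous.
move=> u; apply: (@cvg_sum_fun _ _ _ (nbhs u) (nbhs_filter u)) => i.
by apply: cvgM; exact: c1.
Qed.

Lemma dotv_orbit (M : 'M[R]_n) s : let P := (orbit_pt C s).1 in
  dotv (M *m P) (M *m P) = dotv (M *m C s) (M *m C s) / (1 + r s).
Proof.
have r0 : 0 < 1 + r s by rewrite ltr_pwDl // sqC_ge0.
rewrite /= -scalemxAr dotvZl dotvZr mulrA -invfM -expr2 enorm_sqr -/(r s).
by rewrite sqr_sqrtr ?(ltW r0) // mulrC.
Qed.

Lemma omega_dotv (M : 'M[R]_n) P T (e : R) s0 :
  omega_limit (orbit_pt C) (P, T) -> 0 < e ->
  exists2 s, s0 <= s &
    `|dotv (M *m P) (M *m P) - dotv (M *m C s) (M *m C s) / (1 + r s)| < e.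
Proof.
move=> om e0.
have cf : {for (P, T), continuous (fun x : 'cV[R]_n * 'cV[R]_n =>
    dotv (M *m x.1) (M *m x.1))}.
  apply: (@continuous_comp _ _ _ (fun x : 'cV[R]_n * 'cV[R]_n => x.1)
    (fun u => dotv (M *m u) (M *m u)) (P, T)); first exact: cvg_fst.
  exact: continuous_dotv_mulmx.
have [s ss] := omega_approx s0 cf om e0.
by rewrite dotv_orbit; exists s.
Qed.

Lemma omega_ball P T : omega_limit (orbit_pt C) (P, T) -> enorm P <= 1 /\ enorm T = 1.
Proof.
move=> om; split.
  rewrite -sqrtr1; apply: ler_wsqrtr; apply/ler_addgt0Pr => e e0.
  have [s _] := omega_dotv 1%:M 0 om e0; rewrite !mul1mx -/(r s).
  have r0 := sqC_ge0 C s.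
  have : r s / (1 + r s) <= 1 by rewrite ler_pdivrMr; lra.
  by move=> h /ltr_normlP[]; lra.
rewrite -sqrtr1; congr Num.sqrt; apply/eqP; rewrite -subr_eq0 -normr_le0.
apply/ler_addgt0Pr => e e0; rewrite add0r.
have cf : {for (P, T), continuous (fun x : 'cV[R]_n * 'cV[R]_n =>
    dotv (1%:M *m x.2) (1%:M *m x.2))}.
  apply: (@continuous_comp _ _ _ (fun x : 'cV[R]_n * 'cV[R]_n => x.2)
    (fun u => dotv (1%:M *m u) (1%:M *m u)) (P, T)); first exact: cvg_snd.
  exact: continuous_dotv_mulmx.
have [s _] := omega_approx 0 cf om e0.
by rewrite /= !mul1mx -/(tang C s) (dotv_tang C_soliton) => /ltW.
Qed.

(** A limit point outside the null space of A gives a lower bound for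
    |A C| / |C| infinitely often. *)
Lemma sqAC_often :
  ~ (omega_limit (orbit_pt C) `<=` null_closure A `*` @unit_sphere R n) ->
  exists2 c : R, 0 < c & forall s0, exists2 s, s0 <= s & c * (1 + r s) <= w s.
Proof.
move=> nsub; apply: contrapT => hc; apply: nsub => -[P T] om.
have [P1 T1] := omega_ball om; split=> //; split=> //=; apply: contrapT => AP.
have AP0 : 0 < dotv (A *m P) (A *m P).
  by rewrite lt_def dotv_ge0 dotv_eq0 andbT; apply/eqP.
apply: hc; exists (dotv (A *m P) (A *m P) / 2); first by rewrite divr_gt0.
move=> s0; have AP2 : 0 < dotv (A *m P) (A *m P) / 2 by rewrite divr_gt0.
have [s ss /ltr_normlP[_ h]] := omega_dotv A s0 om AP2.
have r0 := sqC_ge0 C s.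
by exists s => //; rewrite -ler_pdivlMr ?ltr_pwDl // /sqAC; lra.
Qed.

(** Along the spiral, |A C| / |C| stays away from 0, hence A does not annihilate
    any limit point. *)
Lemma omega_null_disjoint (c s0 : R) : 0 < c ->
  (forall t, s0 <= t -> c * r t <= w t /\ 1 <= r t) ->
  forall P T, omega_limit (orbit_pt C) (P, T) -> A *m P <> 0.
Proof.
move=> c0 hs P T om AP; have c2 : 0 < c / 2 by rewrite divr_gt0.
have [s ss] := omega_dotv A s0 om c2.
have [h1 h2] := hs s ss; rewrite AP dotv0l sub0r normrN -/(w s) => h3.
have : c / 2 <= w s / (1 + r s).
  rewrite ler_pdivlMr; last by lra.
  by have := ler_wpM2l (ltW c0) h2; lra.
by have := ler_norm (w s / (1 + r s)); lra.
Qed.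

(** From s0 on the curve stays in the region described by [persistence]. *)
Section Spiral.
Context {N K s0 : R} (S : soliton_system N) (K0 : 0 < K).
Context (good : forall t, s0 <= t -> [/\ 1 <= r t, m t < 0, k t * r t <= K &
  [/\ - alpha / 2 * r t <= - m t * dotCT C t, 0 < dotCT C t &
      (alpha * r t - m t * dotCT C t) ^+ 2 <= K]]).

Let a0 : alpha < 0. Proof. exact: ss_alpha S. Qed.

Lemma muE t : mu alpha A (C t) (derive1 C t) = (lena alpha r w t)^-1 * m t.
Proof. by rewrite /mu dotvZl enorm_avec. Qed.

Lemma in_Rminus : forall M : R, exists2 M' : R, M <= M' &
  \forall s \near +oo_R, Rminus alpha A M' (C s, derive1 C s).
Proof.
move=> M; have N0 := ss_N S; have al := a0.
have a2 : 0 < alpha ^+ 2 by rewrite exprn_even_gt0 //= lt_eqF.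
pose M1 := Num.max M ((alpha ^+ 2 + N) * K).
exists M1; first by rewrite le_max lexx.
have h := radius_to_infty S good (M1 ^+ 2 / alpha ^+ 2).
have hs : \forall t \near +oo_R, s0 <= t by apply: nbhs_pinfty_ge; exact: num_real.
near=> t.
have st : s0 <= t by near: t.
have rt : M1 ^+ 2 / alpha ^+ 2 <= r t by near: t.
have [r1 m0 kr _] := good st; have l0 := lena_gt0 S good st.
have l2 := lena_sqr S t.
have M1l : M1 <= lena alpha r w t.
  have : M1 ^+ 2 <= lena alpha r w t ^+ 2.
    rewrite l2; rewrite ler_pdivrMr // mulrC in rt.
    by have := ss_w S t; lra.
  by move/(sqr_le_itv (ltW l0)) => -[].
split=> /=; rewrite ?enorm_avec ?muE //.
- rewrite /nu enorm_avec muE.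
  have -> : lena alpha r w t ^+ 4 * (1 - ((lena alpha r w t)^-1 * m t) ^+ 2) =
    lena alpha r w t ^+ 2 * (lena alpha r w t ^+ 2 - m t ^+ 2).
    by field; rewrite gt_eqF.
  rewrite {2}l2 -(ss_kE S) l2 le_max; apply/orP; right.
  apply: (@le_trans _ _ ((alpha ^+ 2 + N) * r t * k t)).
    rewrite ler_wpM2r ?(ss_k S) // mulrDl lerD2l.
    exact: ss_wr S t.
  by rewrite -mulrA (mulrC (r t)) ler_wpM2l //; have := sqr_ge0 alpha; lra.
- by rewrite pmulr_rlt0 // invr_gt0.
Unshelve. all: by end_near. Qed.

Lemma log_parameter_exists : exists sigma, log_parameter alpha A C sigma.
Proof.
have cl t : s0 <= t -> {for t, continuous (fun t => (lena alpha r w t)^-1)}.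
  move=> st; have l0 := lena_gt0 S good st.
  apply: cvgV; first by rewrite gt_eqF.
  apply: continuous_comp; last exact: sqrt_continuous.
  apply: is_derive_continuous.
  exact: is_deriveD_fun (is_deriveZ_fun (alpha ^+ 2) (ss_dr S t)) (ss_dw S t).
have [F hF] := antiderivative cl.
exists F; exists s0; split; first exact: num_real.
move=> t /= st; have l0 := lena_gt0 S good (ltW st).
split; last by rewrite enorm_avec; exact: hF.
apply: contraTN l0 => /eqP a_0; rewrite -enorm_avec a_0.
by rewrite /enorm dotv0l sqrtr0 ltxx.
Qed.

Lemma spiral (sigma : R -> R) : log_parameter alpha A C sigma ->
  sigma s @[s --> +oo_R] --> +oo_R /\
  exists2 Gamma : 'cV[R]_n, Gamma != 0 &
    exists M : R, \forall s \near +oo_R,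
      enorm (C s - expmx (- sigma s *: B) *m Gamma) <= M * expR (alpha * sigma s).
Proof.
move=> [M0 [_ hM0]]; pose s1 := Num.max s0 (M0 + 1).
have s01 : s0 <= s1 by rewrite le_max lexx.
have dsigma t : s1 <= t -> is_derive t 1 sigma (lena alpha r w t)^-1.
  rewrite ge_max => /andP[_ ht]; have [_] : avec alpha A (C t) != 0 /\
      is_derive t 1 sigma (enorm (avec alpha A (C t)))^-1 by apply: hM0; lra.
  by rewrite enorm_avec.
have sinf := sigma_to_infty S K0 good s01 dsigma.
split=> //; have al := a0.
have [D D0 speed] := unwound_speed S K0 good s01 dsigma.
have [Z1 [Z2 [Z10 _ hZ]]] := scaled_bounds S K0 good s01 dsigma.
(* Y is the curve with the rotation and dilation undone; G bounds its distance
   to the limit. *)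
pose Y t := expmx (sigma t *: B) *m C t.
pose dY t :=
  expmx (sigma t *: B) *m ((lena alpha r w t)^-1 *: avec alpha A (C t) + tang C t).
pose D' := D / (- (2 * alpha)).
have D'0 : 0 < D' by rewrite divr_gt0 //; lra.
pose G t := D' * expR (2 * alpha * sigma t).
pose dG t := D' * (2 * alpha * (lena alpha r w t)^-1 * expR (2 * alpha * sigma t)).
have lpos t : s1 <= t -> 0 < lena alpha r w t.
  by move=> st; exact: (lena_gt0 S good (le_trans s01 st)).
have dGE t : s1 <= t -> dG t = - (D * expR (2 * alpha * sigma t) / lena alpha r w t).
  move=> st; have ln := lt0r_neq0 (lpos t st); have an : alpha != 0 by rewrite lt_eqF.
  by rewrite /dG /D'; field; rewrite ?an ?ln.
clearbody D'.
have hdY t : s1 <= t -> is_vderive Y t (dY t).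
  move=> st; have hC := is_vderiveC C_soliton t.
  have hP i j : is_derive t 1 (fun t => expmx (sigma t *: B) i j)
      (((lena alpha r w t)^-1 *: (expmx (sigma t *: B) *m B)) i j).
    apply: is_derive_eq.
      exact: (is_derive1_comp (is_derive_expmx B (sigma t) i j) (dsigma t st)).
    by rewrite [RHS]mxE mulrC.
  have := is_vderive_mulmx_fun hP hC.
  by rewrite -scalemxAl -mulmxA scalemxAr -mulmxDr.
have hdG t : s1 <= t -> is_derive t 1 G (dG t).
  move=> st; apply: is_deriveZ_fun; apply: is_derive_expR_fun.
  exact: is_deriveZ_fun (dsigma t st).
have sp t : s1 <= t -> dotv (dY t) (dY t) <= dG t ^+ 2.
  move=> st; have l0 := lpos t st; rewrite dGE // sqrrN.
  apply: le_trans (speed t st); rewrite /dY (dotv_Phi alpha A_anti) ler_wpM2l ?expR_ge0 //.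
  rewrite dotvDl !dotvDr !dotvZl !dotvZr (dotv_tang C_soliton).
  rewrite (dotvC (tang C t)) -/(m t) -/(sqa alpha A C t) (sqaE alpha C A_anti).
  rewrite -(lena_sqr S); set l := lena _ _ _ _ in l0 *.
  suff -> : l^-1 * (l^-1 * l ^+ 2) + l^-1 * m t + (l^-1 * m t + 1) =
    2 * (l + m t) / l by [].
  by field; rewrite gt_eqF.
have dG0 t : s1 <= t -> dG t <= 0.
  move=> st; rewrite dGE // oppr_le0 divr_ge0 ?mulr_ge0 ?expR_ge0 ?(ltW D0) //.
  exact: ltW (lpos t st).
have G0 t : s1 <= t -> 0 <= G t by move=> _; rewrite mulr_ge0 ?expR_ge0 // ltW.
have [Gamma hG] := curve_limit hdY hdG sp dG0 G0.
exists Gamma.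
  (* If Gamma were 0, then |Y|^2, which is bounded below by Z1, would be at most
     n G^2 and hence tend to 0. *)
  apply/eqP => Gamma0.
  pose M := n%:R * D' ^+ 2 / (Z1 * (- (4 * alpha))).
  have hM : \forall t \near +oo_R, M <= sigma t by move/cvgryPge: sinf; exact.
  have hs : \forall t \near +oo_R, s1 <= t by apply: nbhs_pinfty_ge; exact: num_real.
  near +oo_R => t.
  have st : s1 <= t by near: t.
  have Mt : M <= sigma t by near: t.
  have := hG t st; rewrite Gamma0 subr0 (dotv_Phi alpha A_anti).
  rewrite -/(r t) -/(scaled alpha r sigma t).
  have /andP[hz _] := hZ t st; apply/negP; rewrite -ltNge.
  apply: lt_le_trans hz.
  have e0 := expR_gt0 (- (4 * alpha) * sigma t).
  have GE : G t ^+ 2 * expR (- (4 * alpha) * sigma t) = D' ^+ 2.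
    have -> : expR (- (4 * alpha) * sigma t) = (expR (2 * alpha * sigma t) ^+ 2)^-1.
      by rewrite expr2 -expRD -expRN; congr expR; ring.
    by rewrite /G exprMn mulfK // expf_neq0 // gt_eqF // expR_gt0.
  rewrite -(ltr_pM2r e0) -mulrA GE.
  apply: (@lt_le_trans _ _ (Z1 * (1 + - (4 * alpha) * sigma t))); last first.
    by rewrite ler_pM2l // expR_ge1Dx.
  have Z4 : 0 < Z1 * (- (4 * alpha)) by rewrite mulr_gt0 //; lra.
  move: Mt; rewrite /M ler_pdivrMr //; lra.
exists ((n%:R + 1) * D').
have hs : \forall t \near +oo_R, s1 <= t by apply: nbhs_pinfty_ge; exact: num_real.
near=> t.
have st : s1 <= t by near: t.
have -> : C t - expmx (- sigma t *: B) *m Gamma =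
    expmx (- sigma t *: B) *m (Y t - Gamma).
  by rewrite mulmxBr /Y mulmxA Phi_inv mul1mx.
have n0 : 0 <= n%:R :> R by [].
have E0 := expR_gt0 (alpha * sigma t).
have b0 : 0 <= (n%:R + 1) * D' * expR (alpha * sigma t).
  by apply: mulr_ge0; [apply: mulr_ge0; [exact: addr_ge0|exact: ltW]|exact: ltW].
rewrite -ler_sqr ?nnegrE ?enorm_ge0 // enorm_sqr (dotv_Phi alpha A_anti).
apply: (@le_trans _ _ (expR (2 * alpha * - sigma t) * (n%:R * G t ^+ 2))).
  by rewrite ler_wpM2l ?expR_ge0 // hG.
have e2 : expR (2 * alpha * sigma t) = expR (alpha * sigma t) ^+ 2.
  by rewrite expr2 -expRD; congr expR; ring.
have -> : expR (2 * alpha * - sigma t) = (expR (alpha * sigma t) ^+ 2)^-1.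
  by rewrite -e2 -expRN mulrN.
rewrite /G e2; set E := expR _ in E0 *.
have -> : (E ^+ 2)^-1 * (n%:R * (D' * E ^+ 2) ^+ 2) = n%:R * (D' * E) ^+ 2.
  by field; rewrite gt_eqF.
rewrite -mulrA [leRHS]exprMn ler_wpM2r ?sqr_ge0 // sqrrD.
by have := sqr_ge0 (n%:R : R); lra.
Unshelve. all: by end_near. Qed.

End Spiral.
End Solitons.

Theorem lemma8p5 (R : realType) (n : nat) (alpha : R) (A : 'M[R]_n)
    (C : R -> 'cV[R]_n)
    (alpha_lt0 : alpha < 0) (A_neq0 : A != 0) (A_anti : A^T = - A)
    (C_soliton : soliton alpha A C)
    (V_plus : Vfun alpha A (C s) (derive1 C s) @[s --> +oo_R] --> (0 : R))
    (omega_notin :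
      ~ (omega_limit (orbit_pt C) `<=` null_closure A `*` @unit_sphere R n)) :
  [/\ forall K0 : R, exists2 K : R, K0 <= K &
        \forall s \near +oo_R, Rminus alpha A K (C s, derive1 C s),
      exists sigma : R -> R, log_parameter alpha A C sigma,
      forall sigma : R -> R, log_parameter alpha A C sigma ->
        sigma s @[s --> +oo_R] --> +oo_R /\
        exists2 Gamma : 'cV[R]_n, Gamma != 0 &
          exists M : R, \forall s \near +oo_R,
            enorm (C s - expmx (- sigma s *: (alpha%:M + A)) *m Gamma)
              <= M * expR (alpha * sigma s) &
      forall P T : 'cV[R]_n,
        omega_limit (orbit_pt C) (P, T) -> A *m P <> 0].
Proof.
have [N S] := soliton_scalar A_anti C_soliton alpha_lt0.
have V0 : lyap alpha (sqC C) (dotTAC A C) s @[s --> +oo_R] --> (0 : R).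
  suff -> : lyap alpha (sqC C) (dotTAC A C) =
    (fun s => Vfun alpha A (C s) (derive1 C s)) by [].
  by apply/funext => s; rewrite /Vfun enorm_sqr.
have q_le0 := dotTAC_le0 S V0.
have [c0 c00 often] := sqAC_often C_soliton omega_notin.
have [c [K [s0 [c_gt0 K0 all]]]] :=
  persistence S q_le0 c00 (radius_unbounded S V0 c00 often).
have good t : s0 <= t -> [/\ 1 <= sqC C t, tana alpha A C t < 0,
    sqcurv alpha A C t * sqC C t <= K &
    [/\ - alpha / 2 * sqC C t <= - tana alpha A C t * dotCT C t, 0 < dotCT C t &
        (alpha * sqC C t - tana alpha A C t * dotCT C t) ^+ 2 <= K]].
  by move=> /all[].
split.
- exact: (in_Rminus A_anti S good).
- exact: (log_parameter_exists A_anti S good).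
- exact: (spiral A_anti C_soliton S K0 good).
- by apply: (omega_null_disjoint c_gt0 (s0 := s0)) => t /all[].
Qed.
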